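(* Let $\mathcal{X}$ be a superelliptic curve with affine equation $y^n=f(x)$, where $f$ has distinct roots, $\deg f=d>n$ and $\gcd(n,d)=1$, and let $g$ be its genus. Then $B_{n,d}$ is an $n\times(d+1)$ matrix, and the non-zero entries in the $j$-th row, for $j=0,\dots,n-1$, are given by the monomials $x^iy^j$ for $0\leq i\leq\left\lfloor\frac{3g-jd}{n}\right\rfloor$.
   Context: The monomials $x^iy^j$ ($i\geq 0$, $0\leq j\leq n-1$) are regular away from the point at infinity $\infty$ and have pole order $\operatorname{ord}_\infty(x^iy^j)=ni+dj$ there; order them by increasing pole order at $\infty$. The corresponding matrix $B_{n,d}$ has rows indexed by $j=0,\dots,n-1$ (the power of $y$) and columns indexed by $i=0,1,\dots$ (the power of $x$); its $(j,i)$ entry is $x^iy^j$ if this monomial is among the first $2g+1$ monomials in this ordering, and $0$ otherwise.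
   Formalization: That B is n×(d+1) is only a format: for n=7, d=8 (g=21) the monomial x^9 lies in column 9>d, so the size claim is false; the row description is proved for all columns i≥0 and for the matrix cut to d+1 columns. The field is algebraically closed with n invertible. *)

(* Defs.v *)
From HB Require Import structures.
From mathcomp Require Import all_boot all_order all_algebra all_field.
From mathcomp Require Import boolp.
From mathcomp Require Import freeg.

Set Implicit Arguments.
Unset Strict Implicit.
Unset Printing Implicit Defensive.

Import Order.TTheory GRing.Theory Num.Theory.
Local Open Scope ring_scope.

(* A curve over K is handled through its function field F, presented as a     *)
(* finite extension of K(x) = {fraction {poly K}}.                            *)

Section FunctionField.

Variables (K : closedFieldType) (F : fieldExtType {fraction {poly K}}).

Definition ratfun (p : {poly K}) : F := (tofrac p)%:A.

Definition xcoord : F := ratfun 'X.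

Definition cst (c : K) : F := ratfun c%:P.

(* The points of the smooth projective model of F / K are the normalized      *)
(* discrete valuations of F that are trivial on K.  The value at 0, which     *)
(* should be +oo, is set to 0 by convention: without it, one point would be   *)
(* represented by several valuation functions.                                *)
Record place := Place {
  ord_at :> F -> int;
  ord_at0 : ord_at 0 = 0;
  ord_atM : forall u v : F, u != 0 -> v != 0 ->
    ord_at (u * v) = ord_at u + ord_at v;
  ord_atD : forall u v : F, u != 0 -> v != 0 -> u + v != 0 ->
    Num.min (ord_at u) (ord_at v) <= ord_at (u + v);
  ord_at_cst : forall c : K, ord_at (cst c) = 0;
  ord_at_uniformizer : exists t : F, ord_at t = 1
}.

HB.instance Definition _ := gen_eqMixin place.
HB.instance Definition _ := gen_choiceMixin place.

Definition divisor : Type := {freeg place / int}.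

Definition divisor_deg (D : divisor) : int := deg D.

Definition RRspace (D : divisor) (h : F) : Prop :=
  h = 0 \/ forall P : place, - coeff P D <= P h.

(* S is a K-subspace of F of dimension l.                                     *)
Definition has_dim (S : F -> Prop) (l : nat) : Prop :=
  exists b : 'I_l -> F,
    (forall c : 'I_l -> K, \sum_i cst (c i) * b i = 0 -> forall i, c i = 0) /\
    (forall h : F, S h <-> exists c : 'I_l -> K, h = \sum_i cst (c i) * b i).

(* g is the maximum over all divisors D of deg D + 1 - l(D); since K is       *)
(* algebraically closed, every point has degree 1.                            *)
Definition is_genus (g : nat) : Prop :=
  (forall (D : divisor) (l : nat), has_dim (RRspace D) l ->
     divisor_deg D + 1 - l%:Z <= g%:Z) /\
  (exists (D : divisor) (l : nat), has_dim (RRspace D) l /\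
     divisor_deg D + 1 - l%:Z = g%:Z).

End FunctionField.

Definition distinct_roots (K : closedFieldType) (f : {poly K}) : Prop :=
  exists2 rs : seq K, uniq rs &
    f = lead_coef f *: \prod_(z <- rs) ('X - z%:P).

(* F is the function field K(x, y) of the curve y^n = f(x).                   *)
Definition superelliptic (K : closedFieldType)
    (F : fieldExtType {fraction {poly K}})
    (n : nat) (f : {poly K}) (y : F) : Prop :=
  y ^+ n = ratfun F f /\ <<1%VS; y>>%VS = fullv.

Section MonomialMatrix.

Variables (K : closedFieldType) (F : fieldExtType {fraction {poly K}}).
Variables (n : nat) (y : F) (oo : place F).

(* The index (j, i) stands for x^i y^j: row j, column i.                      *)
Definition monom (m : 'I_n * nat) : F := xcoord F ^+ m.2 * y ^+ m.1.

Definition pole_order (m : 'I_n * nat) : int := - oo (monom m).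

(* m is one of the first N monomials, by increasing pole order at infinity:   *)
(* fewer than N monomials have a smaller pole order.                          *)
Definition among_first (N : nat) (m : 'I_n * nat) : Prop :=
  forall s : seq ('I_n * nat), uniq s ->
    (forall m' : 'I_n * nat, m' \in s -> pole_order m' < pole_order m) ->
    (size s < N)%N.

Definition Bentry (g : nat) (j : 'I_n) (i : nat) : F :=
  if `[< among_first (2 * g + 1)%N (j, i) >] then monom (j, i) else 0.

(* The number of columns d + 1 is a format, not a bound on the support of     *)
(* Bentry: trailing columns may vanish (n = 2), and for larger n a monomial   *)
(* with i > d can be among the first 2g + 1 (n = 7, d = 8, g = 21: x^9).      *)
Definition Bmx (g d : nat) : 'M[F]_(n, d.+1) :=
  \matrix_(j < n, i < d.+1) Bentry g j i.

End MonomialMatrix.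

(* Main.v *)
Require Import Defs.
From HB Require Import structures.
From mathcomp Require Import all_boot all_order all_algebra all_field.
From mathcomp Require Import boolp freeg zify ring lra.

(* The genus g satisfies 2g = (n-1)(d-1), and the rest is a count of pole     *)
(* orders: the monomials x^i y^j have the pairwise distinct pole orders       *)
(* n i + d j, and exactly 2g + 1 of them have pole order at most 3g.          *)
(*                                                                            *)
(* A place P with P(x) < 0 is unique, with P(x) = -n and P(y) = -d, because   *)
(* the terms r_j(x) y^j of a function have distinct valuations.  The other    *)
(* places correspond to the points (a, b) of the affine curve; P(x - a) is n  *)
(* if b = 0 and 1 otherwise, so these ramification indices add up to n above  *)
(* each a.  The functions that are regular at all of them form K[x, y], hence *)
(* l(M oo) is the number of monomials of pole order at most M, which is       *)
(* M + 1 - (n-1)(d-1)/2 for large M: this bounds g from below.  For the other *)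
(* bound, given a divisor D, divide the monomials by a polynomial q(x) with   *)
(* large zeros at the finite part of D, and impose the order conditions of D  *)
(* one at a time; each one lowers the dimension by at most 1.                 *)

Set Implicit Arguments.
Unset Strict Implicit.
Unset Printing Implicit Defensive.

Import Order.TTheory GRing.Theory Num.Theory.
Local Open Scope ring_scope.

(** * Valuations *)

(** The monomials x^i y^j with j < n have the pole orders ni + dj, which are distinct because n and
    d are coprime. Row j holds floor((M - dj)/n) + 1 monomials of pole order at most M as long as dj
    <= M + n. Summed over j, where the remainders modulo n run over all residues, this gives M + 1 -
    (n-1)(d-1)/2 monomials ([size_small_monoms_eq]). With 2g = (n-1)(d-1) and M = 3g the count is 2g
    + 1, so the first 2g + 1 monomials are those with ni + dj <= 3g ([among_firstE]), which bounds i
    by floor((3g - jd)/n).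

    The genus is given as the maximum of deg D + 1 - l(D), so most of the work goes into
    [genus_formula]. For the lower bound, the monomials of pole order at most M form a basis of L(M
    oo) ([has_dim_infty]). This rests on [finite_integral], hence on a description of all places:
    [infty_unique] at infinity, [place_center] and [exists_local_param] at affine points. The upper
    bound is [genus_le], an explicit form of Riemann's inequality, obtained by imposing order
    conditions one at a time ([codim_steps_seq]). *)

Section Ratfun.

Variables (K : closedFieldType) (F : fieldExtType {fraction {poly K}}).

HB.instance Definition _ := GRing.RMorphism.copy (@ratfun K F)
  (in_alg F \o @tofrac {poly K}).
HB.instance Definition _ := GRing.RMorphism.copy (@cst K F)
  (@ratfun K F \o polyC).

Lemma ratfun_eq0 (p : {poly K}) : (ratfun F p == 0) = (p == 0).
Proof. by rewrite (fmorph_eq0 (in_alg F)) tofrac_eq0. Qed.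

Lemma ratfunC (c : K) : ratfun F c%:P = cst F c.
Proof. by []. Qed.

Lemma ratfunB : {morph @ratfun K F : p q / p - q}. Proof. exact: rmorphB. Qed.
Lemma ratfunM : {morph @ratfun K F : p q / p * q}. Proof. exact: rmorphM. Qed.
Lemma cstB : {morph @cst K F : p q / p - q}. Proof. exact: rmorphB. Qed.
Lemma cstM : {morph @cst K F : p q / p * q}. Proof. exact: rmorphM. Qed.
Lemma cstXn m : {morph @cst K F : c / c ^+ m}. Proof. exact: rmorphXn. Qed.
Lemma cst0 : cst F 0 = 0. Proof. exact: rmorph0. Qed.
Lemma cst_eq0 c : (cst F c == 0) = (c == 0).
Proof. by rewrite ratfun_eq0 polyC_eq0. Qed.

Lemma ratfun_XsubC (a : K) : ratfun F ('X - a%:P) = xcoord F - cst F a.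
Proof. by rewrite rmorphB. Qed.

Lemma ratfun_sum (p : {poly K}) :
  ratfun F p = \sum_(i < size p) cst F p`_i * xcoord F ^+ i.
Proof.
rewrite -[in LHS](coefK p) poly_def rmorph_sum; apply: eq_bigr => i _.
by rewrite -mul_polyC rmorphM rmorphXn.
Qed.

End Ratfun.

Section Valuations.

Variables (K : closedFieldType) (F : fieldExtType {fraction {poly K}}).
Implicit Types (P : place F) (u v w h : F) (z : int).

Lemma ord1 P : P 1 = 0.
Proof. by rewrite -(ord_at_cst P 1) rmorph1. Qed.

Lemma ordN P u : P (- u) = P u.
Proof.
have [->|u0] := eqVneq u 0; first by rewrite oppr0.
have c0 : cst F (-1) != 0 by rewrite rmorphN1 oppr_eq0 oner_eq0.
by rewrite -mulN1r -(rmorphN1 (cst F)) ord_atM // ord_at_cst add0r.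
Qed.

Lemma ordX P u m : P (u ^+ m) = P u *+ m.
Proof.
have [->|u0] := eqVneq u 0.
  by case: m => [|m]; rewrite ?expr0 ?ord1 // exprS mul0r ord_at0 mul0rn.
elim: m => [|m IHm]; first by rewrite expr0 ord1.
by rewrite exprS ord_atM ?expf_neq0 // IHm mulrS.
Qed.

Lemma ordV P u : P u^-1 = - P u.
Proof.
have [->|u0] := eqVneq u 0; first by rewrite invr0 ord_at0.
apply/eqP; rewrite eq_sym -subr_eq0 -opprD oppr_eq0 -ord_atM ?invr_eq0 //.
by rewrite mulfV ?ord1.
Qed.

(** Restores the usual convention P(0) = +oo, which the stored value [P 0 = 0] breaks; the functions
    satisfying it then form a K-space. *)
Definition vge P z h := (h == 0) || (z <= P h).

Lemma vge0 P z : vge P z 0.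
Proof. by rewrite /vge eqxx. Qed.

Lemma vge_neq0 P z h : h != 0 -> vge P z h = (z <= P h).
Proof. by rewrite /vge => /negPf->. Qed.

Lemma vge_le P z z' h : z' <= z -> vge P z h -> vge P z' h.
Proof. by move=> le /orP[/eqP->|le'];
  rewrite ?vge0 // /vge (le_trans le) ?orbT. Qed.

Lemma vgeD P z u v : vge P z u -> vge P z v -> vge P z (u + v).
Proof.
have [->|u0] := eqVneq u 0; first by rewrite add0r.
have [->|v0] := eqVneq v 0; first by rewrite addr0.
have [->|uv0] := eqVneq (u + v) 0; first by rewrite vge0.
rewrite !vge_neq0 // => zu zv.
by apply: le_trans (ord_atD P u0 v0 uv0); rewrite le_min zu.
Qed.

Lemma vge_sum P z (I : Type) (r : seq I) (Q : pred I) (E : I -> F) :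
  (forall i, Q i -> vge P z (E i)) -> vge P z (\sum_(i <- r | Q i) E i).
Proof.
by move=> H; apply: (big_ind (vge P z)) => //; [exact: vge0|exact: vgeD].
Qed.

Lemma vgeN P z u : vge P z (- u) = vge P z u.
Proof. by rewrite /vge oppr_eq0 ordN. Qed.

Lemma vgeM P z z' u v : vge P z u -> vge P z' v -> vge P (z + z') (u * v).
Proof.
have [->|u0] := eqVneq u 0; first by move=> _ _; rewrite mul0r vge0.
have [->|v0] := eqVneq v 0; first by move=> _ _; rewrite mulr0 vge0.
rewrite !vge_neq0 ?mulf_neq0 // ord_atM // => zu zv; exact: lerD.
Qed.

Lemma vgeM0 P z u v : vge P z u -> vge P 0 v -> vge P z (u * v).
Proof. by move=> zu zv; rewrite -[z]addr0 vgeM. Qed.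

Lemma vgeM0l P z u v : vge P z u -> vge P 0 v -> vge P z (v * u).
Proof. by rewrite mulrC; apply: vgeM0. Qed.

Lemma vge_cst P c : vge P 0 (cst F c).
Proof. by rewrite /vge ord_at_cst lexx orbT. Qed.

Lemma vgeX P u m : vge P 0 u -> vge P 0 (u ^+ m).
Proof.
move=> Pu; elim: m => [|m IHm]; first by rewrite expr0 /vge ord1 lexx orbT.
by rewrite exprS vgeM0.
Qed.

Lemma vge_gt0_cst P c : vge P 1 (cst F c) -> c = 0.
Proof. by rewrite /vge ord_at_cst orbF fmorph_eq0 => /eqP. Qed.

(** The ultrametric inequality is applied to u + w and to u = (u + w) - w; the second use rules out
    that the order rises. *)
Lemma ordD_lt P u w : u != 0 -> vge P (P u + 1) w ->
  u + w != 0 /\ P (u + w) = P u.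
Proof.
move=> u0; have [->|w0] := eqVneq w 0; first by rewrite addr0.
rewrite vge_neq0 // => lt_uw.
have uw0 : u + w != 0.
  rewrite addr_eq0; apply: contraTneq lt_uw => ->.
  by rewrite ordN gerDl ler10.
split=> //; have := ord_atD P u0 w0 uw0; rewrite -oppr_eq0 in w0.
have uw0' : u + w + - w != 0 by rewrite addrK.
have := ord_atD P uw0 w0 uw0'; rewrite addrK ordN.
by lia.
Qed.

(** A unique nonzero term has minimal order, and by [ordD_lt] it dominates the sum of the others.
    The order of the sum therefore bounds that of each term: nothing cancels. *)
Lemma ord_sum_distinct P (I : finType) (E : I -> F) (i1 : I) :
    E i1 != 0 ->
    (forall i j, E i != 0 -> E j != 0 -> P (E i) = P (E j) -> i = j) ->
  \sum_i E i != 0 /\ exists i, [/\ E i != 0, P (\sum_j E j) = P (E i) &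
    forall j, vge P (P (\sum_j E j)) (E j)].
Proof.
move=> Ei1 inj.
case: (@Order.TotalTheory.arg_minP _ _ _ i1 (fun i => E i != 0) (fun i =>
  P (E i)) Ei1).
move=> i Ei min_i; rewrite (bigD1 i) //=.
have rest : vge P (P (E i) + 1) (\sum_(j | j != i) E j).
  apply: vge_sum => j ji; have [->|Ej] := eqVneq (E j) 0; first exact: vge0.
  rewrite vge_neq0 // lezD1 lt_neqAle min_i // andbT.
  by apply: contraNneq ji => eqij; apply/eqP/esym/inj.
have [sum0 ->] := ordD_lt Ei rest; split=> //; exists i; split=> // j.
by have [->|Ej] := eqVneq (E j) 0; rewrite ?vge0 // vge_neq0 ?min_i.
Qed.

(** All fields but the valuation are proofs of propositions. *)
Lemma eq_place P P' : P =1 P' -> P = P'.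
Proof.
case: P P' => [o o0 oM oD oC oU] [o' o0' oM' oD' oC' oU'] /= /funext eqo.
by subst o'; congr Place; apply: Prop_irrelevance.
Qed.

End Valuations.

(** * The coordinate ring *)

Section Fractions.

Local Open Scope quotient_scope.

Lemma fraction_denom (R : idomainType) (x : {fraction R}) :
  exists2 b : R, b != 0 & exists a, tofrac b * x = tofrac a.
Proof.
elim/quotW: x => -[[a b] /= b0]; exists b => //; exists a.
unlock FracField.tofrac; rewrite -[LHS]FracField.pi_mul.
apply/eqmodP; rewrite /= FracField.equivfE /FracField.mulf /=.
by rewrite !numden_Ratio ?mulf_neq0 ?oner_eq0 // mulr1 mul1r.
Qed.

End Fractions.

Section Polyfun.

Variables (K : closedFieldType) (F : fieldExtType {fraction {poly K}}) (y : F).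
Implicit Types p q : {poly {poly K}}.

(** The function p(x, y): the outer variable of p goes to y, the inner one to x. *)
Definition polyfun p : F := (map_poly (ratfun F) p).[y].

HB.instance Definition _ := GRing.RMorphism.copy polyfun
  (horner_eval y \o map_poly (ratfun F)).

Lemma polyfun0 : polyfun 0 = 0. Proof. exact: rmorph0. Qed.
Lemma polyfun1 : polyfun 1 = 1. Proof. exact: rmorph1. Qed.
Lemma polyfunD : {morph polyfun : p q / p + q}. Proof. exact: rmorphD. Qed.
Lemma polyfunB : {morph polyfun : p q / p - q}. Proof. exact: rmorphB. Qed.
Lemma polyfunM : {morph polyfun : p q / p * q}. Proof. exact: rmorphM. Qed.
Lemma polyfunXn m : {morph polyfun : p / p ^+ m}. Proof. exact: rmorphXn. Qed.

Lemma polyfunC (c : {poly K}) : polyfun c%:P = ratfun F c.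
Proof. by rewrite /polyfun map_polyC hornerC. Qed.

Lemma polyfunX : polyfun 'X = y.
Proof. by rewrite /polyfun map_polyX hornerX. Qed.

Lemma polyfun_sum n p : (size p <= n)%N ->
  polyfun p = \sum_(j < n) ratfun F p`_j * y ^+ j.
Proof.
move=> le_pn; rewrite /polyfun (@horner_coef_wide _ n); last first.
  by rewrite (leq_trans _ le_pn) // size_poly.
by apply: eq_bigr => j _; rewrite coef_map.
Qed.

(** As y generates F over K(x), h is a polynomial in y over K(x); the denominators of its
    coefficients are cleared term by term. *)
Lemma polyfun_frac : <<1%VS; y>>%VS = fullv -> forall h : F,
  exists2 R : {poly K}, R != 0 & exists p, ratfun F R * h = polyfun p.
Proof.
move=> gen_y h; pose S u := exists2 R : {poly K}, R != 0 &
  exists p, ratfun F R * u = polyfun p.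
have SD u v : S u -> S v -> S (u + v).
  move=> [R R0 [p Rp]] [R' R0' [p' Rp']]; exists (R * R');
    first by rewrite mulf_neq0.
  exists (R'%:P * p + R%:P * p').
  by rewrite polyfunD !polyfunM !polyfunC !rmorphM /= -Rp -Rp'; ring.
have: h \in <<1%VS; y>>%VS by rewrite gen_y memvf.
case/Fadjoin_polyP => p /polyOverP p1 ->; rewrite horner_coef.
apply: (big_ind S) => //.
  by exists 1; [exact: oner_neq0 | exists 0; rewrite mulr0 polyfun0].
move=> i _; have /vlineP[r ->] := p1 i.
have [b b0 [a eq_ba]] := fraction_denom r.
exists b => //; exists (a%:P * 'X^i).
rewrite polyfunM polyfunXn polyfunC polyfunX /ratfun -eq_ba mulrA.
by rewrite mulr_algl scalerA.
Qed.

End Polyfun.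

Section Curve.

Variables (K : closedFieldType) (F : fieldExtType {fraction {poly K}}).
Variables (n : nat) (f : {poly K}) (y : F).
Hypothesis n_gt0 : (0 < n)%N.
Hypothesis eq_y : y ^+ n = ratfun F f.
Hypothesis gen_y : <<1%VS; y>>%VS = fullv.
Implicit Types p q : {poly {poly K}}.

Definition curve_poly : {poly {poly K}} := 'X^n - f%:P.

Lemma polyfun_curve : polyfun y curve_poly = 0.
Proof. by rewrite polyfunB polyfunXn polyfunX polyfunC eq_y subrr. Qed.

(** Euclidean division by Y^n - f, which is monic in Y and vanishes at (x, y). *)
Lemma curve_reduce p : exists q r,
  [/\ p = q * curve_poly + r, (size r <= n)%N & polyfun y r = polyfun y p].
Proof.
have mc : curve_poly \is monic by rewrite monicXnsubC.
have sc : size curve_poly = n.+1 by rewrite size_XnsubC.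
have e := Pdiv.RingMonic.rdivp_eq mc p.
exists (Pdiv.Ring.rdivp p curve_poly), (Pdiv.Ring.rmodp p curve_poly).
split=> //; first by rewrite -ltnS -sc Pdiv.Ring.ltn_rmodpN0 // monic_neq0.
by rewrite [in RHS]e polyfunD polyfunM polyfun_curve mulr0 add0r.
Qed.

Lemma curve_frac (h : F) : exists2 R : {poly K}, R != 0 &
  exists2 p : {poly {poly K}}, (size p <= n)%N & ratfun F R * h = polyfun y p.
Proof.
have [R R0 [p Rp]] := polyfun_frac gen_y h; exists R => //.
by have [q [r [_ sr er]]] := curve_reduce p; exists r; rewrite ?er.
Qed.

End Curve.

(** * The place at infinity *)

Lemma intMrn (x : int) m : x *+ m = x * m%:Z.
Proof. by rewrite -mulr_natr natz. Qed.

(** n divides d(j' - j), hence j' - j, which is smaller than n in absolute value. *)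
Lemma coprime_affine_inj n d a a' j j' : coprime n d ->
  (j < n)%N -> (j' < n)%N -> (n * a + d * j = n * a' + d * j')%N -> j = j'.
Proof.
move=> co_nd; wlog le_jj : a a' j j' / (j <= j')%N => [IH jn jn' e|jn jn' e].
  case: (leqP j j') => [le_jj|/ltnW le_jj]; first exact: (IH a a').
  by apply/esym/(IH a' a).
have : (n %| d * (j' - j))%N by apply/dvdnP; exists (a - a')%N; nia.
rewrite Gauss_dvdr // => /dvdn_leq; lia.
Qed.

Section Infinity.

Variables (K : closedFieldType) (F : fieldExtType {fraction {poly K}}).
Variables (n d : nat) (f : {poly K}) (y : F).
Hypothesis n_gt0 : (0 < n)%N.
Hypothesis eq_y : y ^+ n = ratfun F f.
Hypothesis gen_y : <<1%VS; y>>%VS = fullv.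
Hypothesis size_f : size f = d.+1.
Hypothesis co_nd : coprime n d.
Implicit Types (p q : {poly {poly K}}) (P : place F).

Lemma curve_y_neq0 : y != 0.
Proof.
apply: contraTneq n_gt0 => y_0; have := eq_y; rewrite y_0 expr0n.
case: n => // m /esym/eqP; rewrite ratfun_eq0 => /eqP f_0.
by move: size_f; rewrite f_0 size_poly0.
Qed.

(** The terms have orders i P(x), which are distinct and smallest for the leading term. *)
Lemma ord_ratfun_infty P (a : {poly K}) : P (xcoord F) < 0 -> a != 0 ->
  P (ratfun F a) = P (xcoord F) *+ (size a).-1.
Proof.
move=> Px a0; rewrite ratfun_sum.
have x0 : xcoord F != 0 by apply: contraTneq Px => ->; rewrite ord_at0.
have sa : (0 < size a)%N by rewrite size_poly_gt0.
pose E (i : 'I_(size a)) := cst F a`_i * xcoord F ^+ i.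
have E0 i : (E i != 0) = (a`_i != 0).
  by rewrite mulf_eq0 expf_eq0 (negPf x0) andbF orbF fmorph_eq0.
have PE i : E i != 0 -> P (E i) = P (xcoord F) *+ i.
  move=> Ei; rewrite ord_atM ?expf_neq0 //; last by rewrite fmorph_eq0 -E0.
  by rewrite ord_at_cst add0r ordX.
have lt_last : ((size a).-1 < size a)%N by rewrite prednK.
pose i1 := Ordinal lt_last.
have Ei1 : E i1 != 0 by rewrite E0 -lead_coefE lead_coef_eq0.
have [|_ [i [Ei eqE minE]]] := ord_sum_distinct Ei1 (P := P).
  move=> i j Ei Ej; rewrite !PE // !intMrn => e.
  have Px0 : P (xcoord F) != 0 by rewrite lt_eqF.
  by case: (mulfI Px0 e) => /val_inj.
have := minE i1; rewrite vge_neq0 // eqE !PE //= => le_i.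
have := ltn_ord i; rewrite -[in X in (_ < X)%N](prednK sa) ltnS => le_i'.
congr (_ *+ _); move: le_i; rewrite !intMrn ler_nM2l // lez_nat => le_i.
by apply/eqP; rewrite eqn_leq le_i le_i'.
Qed.

(** The equation of the curve gives n P(y) = d P(x), and coprimality makes n divide P(x). That k is
    1 is seen later, in [ord_infty_scale]. *)
Lemma ord_infty P : P (xcoord F) < 0 -> exists2 k : int,
  0 < k & P (xcoord F) = - (n%:Z * k) /\ P y = - (d%:Z * k).
Proof.
move=> Px; have f0 : f != 0 by rewrite -size_poly_eq0 size_f.
have := congr1 P eq_y; rewrite ordX ord_ratfun_infty // size_f /= => e.
have : (n%:Z %| P (xcoord F) * d%:Z)%Z.
  by apply/dvdzP; exists (P y); move: e; rewrite !intMrn.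
rewrite Gauss_dvdzl // => /dvdzP[k ek]; exists (- k); first by nia.
by rewrite ek in e *; split; [nia | move: e; rewrite !intMrn; nia].
Qed.

Section Value.

Variables (P : place F) (k : int).
Hypothesis k_gt0 : 0 < k.
Hypothesis Px : P (xcoord F) = - (n%:Z * k).
Hypothesis Py : P y = - (d%:Z * k).

Let x_lt0 : P (xcoord F) < 0.
Proof. by rewrite Px; nia. Qed.

Let y0 := curve_y_neq0.

Lemma ord_term_infty (a : {poly K}) j : a != 0 ->
  P (ratfun F a * y ^+ j) = - ((n * (size a).-1 + d * j)%N%:Z * k).
Proof.
move=> a0; rewrite ord_atM ?ratfun_eq0 ?expf_neq0 //.
by rewrite ord_ratfun_infty // ordX Px Py !intMrn; nia.
Qed.

(** The terms r_j(x) y^j have orders -(n deg r_j + d j) k, distinct by [coprime_affine_inj], so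
    [ord_sum_distinct] applies. In particular 1, y, ..., y^(n-1) are independent over K(x). *)
Lemma ord_polyfun_infty p : (size p <= n)%N -> p != 0 ->
  polyfun y p != 0 /\ exists j : 'I_n, [/\ p`_j != 0,
    P (polyfun y p) = - ((n * (size (p`_j)%R).-1 + d * j)%N%:Z * k) &
    forall i : 'I_n, vge P (P (polyfun y p)) (ratfun F p`_i * y ^+ i)].
Proof.
move=> le_pn p0; rewrite (polyfun_sum y le_pn).
pose E (j : 'I_n) := ratfun F p`_j * y ^+ j.
have E0 j : (E j != 0) = (p`_j != 0).
  by rewrite mulf_eq0 expf_eq0 (negPf y0) andbF orbF ratfun_eq0.
have lt_j : ((size p).-1 < n)%N by rewrite prednK // size_poly_gt0.
have Ej1 : E (Ordinal lt_j) != 0 by rewrite E0 -lead_coefE lead_coef_eq0.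
have [|-> [j [Ej eqE minE]]] := ord_sum_distinct Ej1 (P := P).
  move=> i j; rewrite !E0 => pi pj; rewrite !ord_term_infty // => /oppr_inj.
  move/(mulIf (lt0r_neq0 k_gt0)) => [e].
  exact/val_inj/(coprime_affine_inj co_nd (ltn_ord i) (ltn_ord j) e).
by split=> //; exists j; rewrite -E0; split=> //;
  rewrite eqE ord_term_infty // -E0.
Qed.

(** Every value of P is a multiple of k, and a uniformizer has value 1. *)
Lemma ord_infty_scale : k = 1.
Proof.
have [t Pt] := ord_at_uniformizer P.
have t0 : t != 0 by apply: contra_eqN Pt => /eqP->; rewrite ord_at0.
have [R R0 [p le_pn e]] := curve_frac n_gt0 eq_y gen_y t.
have Rt0 : ratfun F R * t != 0 by rewrite mulf_neq0 ?ratfun_eq0.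
have p0 : p != 0 by apply: contraNneq Rt0 => p_0; rewrite e p_0 rmorph0.
have [_ [j [_ ej _]]] := ord_polyfun_infty le_pn p0.
have := congr1 P e; rewrite ord_atM ?ratfun_eq0 // Pt ej ord_ratfun_infty // Px.
rewrite intMrn; set u := (n * _ + _)%N => eu.
have : (k %| 1)%Z.
  apply/dvdzP; exists (n%:Z * (size R).-1 - u%:Z); lia.
by rewrite dvdz1; lia.
Qed.

End Value.

Lemma infty_ord P : P (xcoord F) < 0 ->
  P (xcoord F) = - n%:Z /\ P y = - d%:Z.
Proof.
case/ord_infty => k k_gt0 [Px Py].
by have k1 := ord_infty_scale k_gt0 Px Py; rewrite Px Py k1 !mulr1.
Qed.

Lemma polyfun_eq0 P p : P (xcoord F) < 0 -> (size p <= n)%N ->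
  (polyfun y p == 0) = (p == 0).
Proof.
case/ord_infty => k k_gt0 [Px Py] le_pn.
have [->|p0] := eqVneq p 0; first by rewrite rmorph0 eqxx.
by case: (ord_polyfun_infty k_gt0 Px Py le_pn p0) => /negPf->.
Qed.

(** Both places give each term r_j(x) y^j the same order, and the order of the sum is the minimum
    over the terms. *)
Lemma infty_unique P P' : P (xcoord F) < 0 -> P' (xcoord F) < 0 -> P = P'.
Proof.
move=> Px P'x; apply: eq_place => h.
have [->|h0] := eqVneq h 0; first by rewrite !ord_at0.
have [R R0 [p le_pn e]] := curve_frac n_gt0 eq_y gen_y h.
have Rh0 : ratfun F R * h != 0 by rewrite mulf_neq0 ?ratfun_eq0.
have p0 : p != 0 by apply: contraNneq Rh0 => p_0; rewrite e p_0 rmorph0.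
have [[k k_gt0 [eP ePy]] [k' k'_gt0 [eP' eP'y]]] :=
  (ord_infty Px, ord_infty P'x).
have := ord_infty_scale k_gt0 eP ePy; have := ord_infty_scale k'_gt0 eP' eP'y.
move=> ? ?; subst k k'.
have [_ [j [pj ej minj]]] := ord_polyfun_infty k_gt0 eP ePy le_pn p0.
have [pp0 [j' [pj' ej' minj']]] := ord_polyfun_infty k'_gt0 eP' eP'y le_pn p0.
have eqP : P (polyfun y p) = P' (polyfun y p).
  have y0 := curve_y_neq0.
  have := minj j'; have := minj' j.
  rewrite !vge_neq0 ?mulf_neq0 ?ratfun_eq0 ?expf_neq0 //.
  rewrite (ord_term_infty k_gt0 eP ePy) // (ord_term_infty k'_gt0 eP' eP'y) //.
  rewrite ej ej'; move: (_ + _)%N (_ + _)%N => u v.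
  by rewrite !mulr1 => le1 le2; apply/eqP; rewrite eq_le le1 le2.
have RF0 : ratfun F R != 0 by rewrite ratfun_eq0.
have := congr1 P e; rewrite eqP -[in RHS]e (ord_atM P RF0 h0) (ord_atM P' RF0
  h0).
rewrite (ord_ratfun_infty Px R0) (ord_ratfun_infty P'x R0) eP eP'.
exact: addrI.
Qed.

End Infinity.

(** * Places at affine points *)

Section LocalPlace.

Variables (K : closedFieldType) (F : fieldExtType {fraction {poly K}}).
Variables (n : nat) (f : {poly K}) (y : F).
Hypothesis n_gt0 : (0 < n)%N.
Hypothesis eq_y : y ^+ n = ratfun F f.
Hypothesis gen_y : <<1%VS; y>>%VS = fullv.
Hypothesis polyfun_inj0 : forall p : {poly {poly K}}, (size p <= n)%N ->
  (polyfun y p == 0) = (p == 0).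
Implicit Types (p q : {poly {poly K}}) (P : place F).

Lemma vge_polyfun P p : vge P 0 (xcoord F) -> vge P 0 y ->
  vge P 0 (polyfun y p).
Proof.
move=> Px Py; rewrite (polyfun_sum y (leqnn (size p))); apply: vge_sum => j _.
apply: vgeM0; last exact: vgeX.
rewrite ratfun_sum; apply: vge_sum => i _.
by apply: vgeM0; [exact: vge_cst | exact: vgeX].
Qed.

Variables (a b : K).
Hypothesis on_curve : b ^+ n = f.[a].

Definition bieval p : K := p.[b%:P].[a].

HB.instance Definition _ := GRing.RMorphism.copy bieval
  (horner_eval a \o horner_eval b%:P).

Lemma bieval1 : bieval 1 = 1. Proof. exact: rmorph1. Qed.
Lemma bievalB : {morph bieval : p q / p - q}. Proof. exact: rmorphB. Qed.
Lemma bievalM : {morph bieval : p q / p * q}. Proof. exact: rmorphM. Qed.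
Lemma bievalXn m : {morph bieval : p / p ^+ m}. Proof. exact: rmorphXn. Qed.

Lemma bievalC (r : {poly K}) : bieval r%:P = r.[a].
Proof. by rewrite /bieval hornerC. Qed.

Lemma bievalX : bieval 'X = b.
Proof. by rewrite /bieval hornerX hornerC. Qed.

(** Evaluation at (a, b) is well defined on K[x, y]: p - q is a multiple of the curve polynomial,
    which vanishes at (a, b). *)
Lemma bieval_polyfun p q : polyfun y p = polyfun y q -> bieval p = bieval q.
Proof.
have [u [r [eu le_r er]]] := curve_reduce n_gt0 eq_y (p - q).
move=> epq; have := polyfun_inj0 le_r; rewrite er polyfunB epq subrr eqxx.
move=> /esym/eqP r0; apply/eqP; rewrite -subr_eq0 -bievalB eu r0 addr0 bievalM.
by rewrite /curve_poly bievalB bievalXn bievalX bievalC on_curve subrr mulr0.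
Qed.

Lemma bieval_eq0 p : bieval p = 0 ->
  exists u v, p = u * ('X - b%:P%:P) + v * ('X - a%:P)%:P.
Proof.
move=> /eqP p0.
have /factor_theorem[u eu] : root (p - p.[b%:P]%:P) b%:P.
  by rewrite /root !hornerE subrr.
have /factor_theorem[v ev] : root p.[b%:P] a by [].
by exists u, v%:P; rewrite -eu -rmorphM -ev subrK.
Qed.

(** The place P lies over the point (a, b): x - a and y - b vanish there. *)
Definition centered P := vge P 1 (xcoord F - cst F a) && vge P 1 (y - cst F b).

Lemma centered_x P : centered P -> vge P 0 (xcoord F).
Proof.
case/andP => Px _; rewrite -(subrK (cst F a) (xcoord F)).
by rewrite vgeD ?vge_cst // (vge_le _ Px).
Qed.

Lemma centered_y P : centered P -> vge P 0 y.
Proof.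
case/andP => _ Py; rewrite -(subrK (cst F b) y).
by rewrite vgeD ?vge_cst // (vge_le _ Py).
Qed.

Lemma centered_bieval0 P p : centered P -> bieval p = 0 ->
  vge P 1 (polyfun y p).
Proof.
move=> cP /bieval_eq0[u [v ->]]; have [Px Py] := andP cP.
have int q : vge P 0 (polyfun y q).
  by apply: vge_polyfun; [exact: centered_x | exact: centered_y].
rewrite polyfunD !polyfunM polyfunB polyfunX !polyfunC ratfunC ratfun_XsubC.
by apply: vgeD; apply: vgeM0l.
Qed.

(** p is its nonzero value at (a, b) plus a function of positive order. *)
Lemma centered_bieval P p : centered P -> bieval p != 0 ->
  polyfun y p != 0 /\ P (polyfun y p) = 0.
Proof.
move=> cP p0; have c0 : cst F (bieval p) != 0 by rewrite fmorph_eq0.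
rewrite -(subrK (polyfun y (bieval p)%:P%:P) (polyfun y p)) polyfunC ratfunC
  addrC.
rewrite -(ord_at_cst P (bieval p)); apply: ordD_lt => //.
rewrite ord_at_cst -ratfunC -(polyfunC y) -polyfunB centered_bieval0 //.
by rewrite bievalB !bievalC hornerC subrr.
Qed.

Lemma polyfun_bieval_neq0 p : bieval p != 0 -> polyfun y p != 0.
Proof.
apply: contraNneq => p0; rewrite (@bieval_polyfun p 0) ?polyfun0 //.
by rewrite -(subrr 0) bievalB subrr.
Qed.

(** The units of the local ring of the curve at (a, b). *)
Definition local_unit (u : F) := exists p q,
  [/\ bieval p != 0, bieval q != 0 & u = polyfun y p / polyfun y q].

Lemma local_unit_polyfun p : bieval p != 0 -> local_unit (polyfun y p).
Proof.
by move=> p0; exists p, 1; rewrite bieval1 polyfun1 oner_neq0 divr1.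
Qed.

Lemma local_unitM u v : local_unit u -> local_unit v -> local_unit (u * v).
Proof.
move=> [p [q [p0 q0 ->]]] [p' [q' [p'0 q'0 ->]]]; exists (p * p'), (q * q').
by split; rewrite ?bievalM ?polyfunM ?mulf_neq0 // mulf_div.
Qed.

Lemma local_unitV u : local_unit u -> local_unit u^-1.
Proof. by move=> [p [q [p0 q0 ->]]]; exists q, p; rewrite invf_div. Qed.

Lemma local_unit_neq0 u : local_unit u -> u != 0.
Proof.
move=> [p [q [p0 q0 ->]]].
by rewrite mulf_neq0 ?invr_eq0 ?polyfun_bieval_neq0.
Qed.

Lemma centered_local_unit P u : centered P -> local_unit u -> P u = 0.
Proof.
move=> cP [p [q [p0 q0 ->]]].
have [[pn0 Pp] [qn0 Pq]] := (centered_bieval cP p0, centered_bieval cP q0).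
by rewrite ord_atM ?invr_eq0 // ordV Pp Pq subrr.
Qed.

(* [t] generates the maximal ideal of the local ring at (a, b): both x - a    *)
(* and y - b are multiples of [t] up to [s], which is invertible there.       *)
Variables (e : nat) (t s u0 v0 : {poly {poly K}}).
Hypothesis e_gt0 : (0 < e)%N.
Hypothesis t_root : bieval t = 0.
Hypothesis s_unit : bieval s != 0.
Hypothesis u0_unit : bieval u0 != 0.
Hypothesis eq_xa : polyfun y s * (xcoord F - cst F a) =
  polyfun y t ^+ e * polyfun y u0.
Hypothesis eq_yb : polyfun y s * (y - cst F b) = polyfun y t * polyfun y v0.

Local Notation T := (polyfun y t).

Lemma local_param_neq0 : T != 0.
Proof.
have xa0 : xcoord F - cst F a != 0.
  by rewrite -ratfun_XsubC ratfun_eq0 polyXsubC_eq0.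
have : polyfun y s * (xcoord F - cst F a) != 0
  by rewrite mulf_neq0 ?polyfun_bieval_neq0.
by rewrite eq_xa; apply: contraNneq => ->; rewrite expr0n gtn_eqF // mul0r.
Qed.

Let T0 := local_param_neq0.

Lemma local_param_dvd p : bieval p = 0 ->
  exists q, polyfun y s * polyfun y p = T * polyfun y q.
Proof.
move=> /bieval_eq0[u [v ->]].
exists (u * v0 + v * t ^+ e.-1 * u0).
rewrite !polyfunD !polyfunM polyfunXn polyfunB polyfunX !polyfunC ratfunC
  ratfun_XsubC.
rewrite mulrDr [X in X + _ = _]mulrCA eq_yb [X in _ + X = _]mulrCA eq_xa.
by rewrite -[in LHS](prednK e_gt0) exprS; ring.
Qed.

(** After cancelling T^m, p would be a multiple of t in K[x, y] and vanish at (a, b). *)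
Lemma local_param_exp_ndvd m p q r : bieval p != 0 ->
  T ^+ m * polyfun y p = T ^+ (m + r.+1) * polyfun y q -> False.
Proof.
move=> p0; rewrite exprD -mulrA => /(mulfI (expf_neq0 _ T0)).
rewrite -polyfunXn -polyfunM => /bieval_polyfun e'; move: p0.
by rewrite e' bievalM bievalXn t_root expr0n mul0r eqxx.
Qed.

(* If R(x) is a nonzero multiple of [p] in K[x, y], then the order of R at     *)
(* (a, b), which is at most [e * k], bounds the number of divisions by [t].   *)
Lemma polyfun_local_param p : polyfun y p != 0 ->
  exists (m : nat) u, local_unit u /\ polyfun y p = T ^+ m * u.
Proof.
move=> p0; have [R R0 [p' _ eR]] :=
  curve_frac n_gt0 eq_y gen_y (polyfun y p)^-1.
have [k [R' R'a eR']] := multiplicity_XsubC R a.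
rewrite R0 in R'a.
have step m : (exists (m : nat) u, local_unit u /\ polyfun y p = T ^+ m * u) \/
    exists q, polyfun y s ^+ m * polyfun y p = T ^+ m * polyfun y q.
  elim: m => [|m [|[q eq]]]; [by right; exists p | by left |].
  have [q0|q0] := eqVneq (bieval q) 0.
    have [q' eq'] := local_param_dvd q0; right; exists q'.
    by rewrite !exprS -mulrA eq mulrCA eq' mulrCA mulrA.
  left; exists m, (polyfun y q / polyfun y (s ^+ m)); split.
    by exists q, (s ^+ m); split=> //; rewrite bievalXn expf_neq0.
  by rewrite mulrA -eq polyfunXn mulrAC divff ?mul1r // expf_neq0
    ?polyfun_bieval_neq0.
have [//|[q eq]] := step (e * k + 1)%N.
have eRp : ratfun F R = polyfun y p' * polyfun y p by rewrite -eR divfK.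
have eRk : polyfun y s ^+ k * ratfun F R =
  T ^+ (e * k) * polyfun y (u0 ^+ k * R'%:P).
  rewrite eR' rmorphM rmorphXn /= ratfun_XsubC polyfunM polyfunXn polyfunC
    exprM mulrCA -exprMn.
  by rewrite eq_xa exprMn; ring.
case: (@local_param_exp_ndvd (e * k) (s ^+ (e * k + 1) * (u0 ^+ k * R'%:P))
  (q * p' * s ^+ k) 0).
  by rewrite !bievalM !bievalXn bievalC !mulf_neq0 ?expf_neq0.
rewrite polyfunM mulrCA -eRk eRp !polyfunM !polyfunXn.
transitivity (polyfun y s ^+ (e * k + 1) * polyfun y p * (polyfun y p' *
  polyfun y s ^+ k)).
  by ring.
by rewrite eq; ring.
Qed.

Lemma local_param_frac h : h != 0 ->
  exists (m : int) u, local_unit u /\ h = T ^ m * u.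
Proof.
move=> h0; have [R R0 [p _ eR]] := curve_frac n_gt0 eq_y gen_y h.
have RF0 : polyfun y R%:P != 0 by rewrite polyfunC ratfun_eq0.
have p0 : polyfun y p != 0 by rewrite -eR mulf_neq0 // -(polyfunC y).
have [m [u [uu em]]] := polyfun_local_param p0.
have [m' [u' [uu' em']]] := polyfun_local_param RF0.
exists (m%:Z - m'%:Z), (u / u'); split; first by apply/local_unitM/local_unitV.
have -> : h = polyfun y p / polyfun y R%:P
  by rewrite -eR polyfunC mulrAC divff ?mul1r // -(polyfunC y).
by rewrite em em' expfzDr // invfM mulrACA exprnN -!exprnP.
Qed.

(** Otherwise a positive power of T would be a local unit, against [local_param_exp_ndvd]. *)
Lemma local_ord_uniq (m m' : int) u u' : local_unit u -> local_unit u' ->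
  T ^ m * u = T ^ m' * u' -> m = m'.
Proof.
wlog lt_mm : m m' u u' / m < m' => [IH Hu Hu' eq|].
  case: (ltgtP m m') => // lt; first exact: (IH m m' u u').
  by apply/esym/(IH m' m u' u).
move=> Hu Hu'; have [r ->] : exists r : nat, m' = m + r.+1%:Z.
  by exists (absz (m' - m - 1)%R); lia.
rewrite expfzDr // -mulrA => /(mulfI (expfz_neq0 _ T0)) eq.
have [p [q [p0 q0 epq]]] := local_unitM Hu (local_unitV Hu').
case: (@local_param_exp_ndvd 0 p q r p0); rewrite expr0 mul1r add0n.
have q'0 := polyfun_bieval_neq0 q0.
rewrite -[LHS](divfK q'0) -epq eq.
by rewrite mulrK ?unitfE ?local_unit_neq0 // -exprnP.
Qed.

(** The valuation sends [T ^ m * u], with [u] a local unit, to m; [T] itself is the uniformizer. *)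
Lemma place_exists : exists P, centered P.
Proof.
have ex_v h : exists m : int, if h == 0 then m = 0 else
    exists2 u, local_unit u & h = T ^ m * u.
  have [_|/local_param_frac[m [u [Hu ->]]]] := eqVneq h 0; first by exists 0.
  by exists m, u.
have [v vP] := choice ex_v.
have v_0 : v 0 = 0 by have := vP 0; rewrite eqxx.
have vE m u : local_unit u -> v (T ^ m * u) = m.
  move=> Hu; have := vP (T ^ m * u).
  rewrite mulf_eq0 (negPf (local_unit_neq0 Hu)) orbF (negPf (expfz_neq0 _ T0)).
  by case=> u' Hu' /esym/local_ord_uniq->.
have vX h : h != 0 -> exists2 u, local_unit u & h = T ^ (v h) * u.
  by move=> h0; have := vP h; rewrite (negPf h0).
have vpoly p : polyfun y p != 0 -> 0 <= v (polyfun y p).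
  by case/polyfun_local_param => m [u [Hu ->]]; rewrite exprnP vE.
have vM u w : u != 0 -> w != 0 -> v (u * w) = v u + v w.
  move=> /vX[u' Hu' eu] /vX[w' Hw' ew]; rewrite {1}eu {1}ew mulrACA -expfzDr //.
  by rewrite vE //; apply: local_unitM.
have unit1 : local_unit 1 by exists 1, 1;
  rewrite bieval1 polyfun1 oner_neq0 divr1.
have vunit u : local_unit u -> v u = 0.
  by move=> Hu; rewrite -(vE 0 u Hu) expr0z mul1r.
(* Once [T ^ v u] is factored out, a polynomial in x and y divided by a local unit remains, and its
   exponent is nonnegative. *)
have vD_wlog u w : u != 0 -> w != 0 -> u + w != 0 -> v u <= v w ->
  v u <= v (u + w).
  move=> /vX[u' Hu' eu] /vX[w' Hw' ew] uw0 le_uw.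
  have [r er] : exists r : nat, v w = v u + r%:Z
    by exists (absz (v w - v u)%R); lia.
  have euw : u + w = T ^ (v u) * (u' + T ^+ r * w').
    by rewrite {1}eu {1}ew er expfzDr // -exprnP; ring.
  have [p [q [p0 q0 epq]]] := Hu'; have [p' [q' [p'0 q'0 epq']]] := Hw'.
  have Hqq : local_unit (polyfun y (q * q')).
    by apply: local_unit_polyfun; rewrite bievalM mulf_neq0.
  have esum : u' + T ^+ r * w' =
      polyfun y (p * q' + t ^+ r * p' * q) / polyfun y (q * q').
    rewrite epq epq' polyfunD !polyfunM polyfunXn.
    by field; rewrite !polyfun_bieval_neq0.
  move: uw0; rewrite {1}euw mulf_eq0 negb_or => /andP[Tu sum0].
  rewrite euw vM // -{1}[v u]addr0.
  have -> : v (T ^ v u) = v u by rewrite -[T ^ v u]mulr1 vE.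
  rewrite lerD2l; move: sum0; rewrite esum mulf_eq0 negb_or => /andP[pn0 qn0].
  by rewrite vM // (vunit _ (local_unitV Hqq)) addr0 vpoly.
have vD u w : u != 0 -> w != 0 -> u + w != 0 ->
  Num.min (v u) (v w) <= v (u + w).
  move=> un0 wn0 uwn0; have [le_uw|/ltW le_wu] := leP (v u) (v w).
    exact: vD_wlog.
  by rewrite addrC; apply: vD_wlog => //; rewrite addrC.
have vC c : v (cst F c) = 0.
  have [->|c0] := eqVneq c 0; first by rewrite rmorph0.
  rewrite -ratfunC -(polyfunC y); apply/vunit/local_unit_polyfun.
  by rewrite !bievalC hornerC.
have vT : v T = 1 by rewrite -[T]mulr1 -[T]expr1z vE.
pose P := Place v_0 vM vD vC (ex_intro _ T vT).
have Ps : P (polyfun y s) = 0 by exact/vunit/local_unit_polyfun.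
have s0 : polyfun y s != 0 by exact: polyfun_bieval_neq0.
have PT q h : polyfun y s * h = T * polyfun y q -> vge P 1 h.
  move=> eq; have [->|h0] := eqVneq h 0; first exact: vge0.
  have q0 : polyfun y q != 0.
    by apply: contraNneq h0 => q0; move/eqP: eq;
      rewrite q0 mulr0 mulf_eq0 (negPf s0).
  have := congr1 P eq; rewrite !ord_atM // Ps add0r vge_neq0 // => ->.
  by rewrite [P T]vT lerDl vpoly.
exists P; rewrite /centered (PT _ _ eq_yb) andbT.
apply: (PT (t ^+ e.-1 * u0)); rewrite eq_xa polyfunM polyfunXn mulrA -exprS.
by rewrite prednK.
Qed.

(** Local units have order 0 at P, so P is P(T) times the T-adic exponent; a uniformizer of P forces
    P(T) = 1. Hence a place centered at (a, b) is determined. *)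
Lemma centered_frac P h m u : centered P -> local_unit u -> h = T ^ m * u ->
  P h = m.
Proof.
have main Q h' m' u' : centered Q -> local_unit u' -> h' = T ^ m' * u' ->
  Q h' = Q T * m'.
  move=> cQ Hu ->; rewrite (ord_atM Q (expfz_neq0 _ T0) (local_unit_neq0 Hu)).
  rewrite (centered_local_unit cQ Hu) addr0.
  by case: m' => k; rewrite ?NegzE -?exprnN -?exprnP ?ordV ordX intMrn //; lia.
move=> cP Hu eh; rewrite (main P h m u) //.
have [w Pw] := ord_at_uniformizer P.
have w0 : w != 0 by apply: contra_eqN Pw => /eqP->; rewrite ord_at0.
have [k [u' [Hu' ew]]] := local_param_frac w0.
have := main P w k u' cP Hu' ew; rewrite Pw.
have := centered_bieval0 cP t_root; rewrite vge_neq0 // => PT eP.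
have : (P T %| 1)%Z by apply/dvdzP; exists k; rewrite mulrC.
by rewrite dvdz1; lia.
Qed.

Lemma centered_unique P Q : centered P -> centered Q -> P = Q.
Proof.
move=> cP cQ; apply: eq_place => h.
have [->|h0] := eqVneq h 0; first by rewrite !ord_at0.
have [m [u [Hu eh]]] := local_param_frac h0.
by rewrite (centered_frac cP Hu eh) (centered_frac cQ Hu eh).
Qed.

Lemma centered_ramif P : centered P -> P (xcoord F - cst F a) = e%:Z.
Proof.
move=> cP; apply: (@centered_frac _ _ _ (polyfun y u0 / polyfun y s)) => //.
  by apply/local_unitM/local_unitV; apply: local_unit_polyfun.
by rewrite -exprnP mulrA -eq_xa mulrAC divff ?mul1r ?polyfun_bieval_neq0.
Qed.

(** The residue field is K: a unit p/q is congruent to its value p(a, b)/q(a, b), and a function of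
    positive order to 0. *)
Lemma centered_residue P h : centered P -> vge P 0 h ->
  exists c, vge P 1 (h - cst F c).
Proof.
move=> cP; have [->|h0] := eqVneq h 0.
  by move=> _; exists 0; rewrite rmorph0 subrr vge0.
rewrite vge_neq0 // => Ph; have [m [u [Hu eh]]] := local_param_frac h0.
have Phm := centered_frac cP Hu eh; rewrite Phm in Ph.
move: Ph; rewrite le_eqVlt => /predU1P[m0|m0]; last first.
  by exists 0; rewrite rmorph0 subr0 vge_neq0 // Phm.
have [p [q [p0 q0 epq]]] := Hu.
have c0 : bieval p / bieval q != 0 by rewrite mulf_neq0 ?invr_eq0.
exists (bieval p / bieval q); set c := _ / _.
have -> : h - cst F c = polyfun y (p - c%:P%:P * q) * (polyfun y q)^-1.
  rewrite eh -m0 expr0z mul1r epq polyfunB polyfunM polyfunC ratfunC mulrBl.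
  by rewrite mulfK ?polyfun_bieval_neq0.
apply: vgeM0; last by rewrite vge_neq0 ?invr_eq0
  ?polyfun_bieval_neq0 // ordV (centered_local_unit cP (local_unit_polyfun
    q0)) oppr0.
apply: centered_bieval0 => //.
by rewrite bievalB bievalM !bievalC hornerC /c divfK ?subrr.
Qed.

End LocalPlace.

Lemma distinct_roots_root (K : closedFieldType) (f : {poly K}) (a : K) :
    distinct_roots f -> f != 0 -> root f a ->
  exists2 f1, f = f1 * ('X - a%:P) & f1.[a] != 0.
Proof.
move=> [rs uniq_rs ef] f0; have c0 : lead_coef f != 0 by rewrite lead_coef_eq0.
rewrite {1}ef rootZ // root_prod_XsubC => a_rs.
exists (lead_coef f *: \prod_(z <- rem a rs) ('X - z%:P)).
  by rewrite {1}ef (big_rem a) //= -scalerAl mulrC.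
rewrite hornerZ mulf_neq0 // -/(root _ _) root_prod_XsubC mem_rem_uniq //.
by rewrite !inE eqxx.
Qed.

Lemma uniq_nth_roots (K : closedFieldType) n (c : K) : n%:R != 0 :> K ->
  c != 0 ->
  exists rs : seq K, [/\ uniq rs, size rs = n & forall b, (b \in rs) =
    (b ^+ n == c)].
Proof.
move=> n0 c0; have natr_neq0_gt0 : (0 < n)%N by case: n n0 => //; rewrite eqxx.
have [rs ers] := closed_field_poly_normal ('X^n - c%:P).
rewrite (eqP (monicXnsubC c natr_neq0_gt0)) scale1r in ers; exists rs; split.
- rewrite -separable_prod_XsubC -ers separable_poly.unlock.
  (* The Bezout relation -c^-1 (X^n - c) + (c^-1/n) X (n X^(n-1)) = 1, where n is invertible in
     K. *)
  apply/Bezout_coprimepP; exists (- c^-1%:P, (c^-1 / n%:R) *: 'X) => /=.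
  rewrite derivB derivXn derivC subr0 -scalerAl mulrnAr -exprS prednK //.
  rewrite -scaler_nat scalerA divfK // mulrBr !mulNr mul_polyC -rmorphM mulVf
    //.
  by rewrite opprK addrC addrA subrr add0r eqpxx.
- by have := congr1 (fun p : {poly K} => size p) ers;
  rewrite size_prod_XsubC size_XnsubC // => -[].
by move=> b; rewrite -root_prod_XsubC -ers /root !hornerE subr_eq0.
Qed.

(** * The affine places and the fibres of x *)

Section Places.

Variables (K : closedFieldType) (F : fieldExtType {fraction {poly K}}).
Variables (n d : nat) (f : {poly K}) (y : F) (oo : place F).
Hypothesis n_neq0 : n%:R != 0 :> K.
Hypothesis f_roots : distinct_roots f.
Hypothesis size_f : size f = d.+1.
Hypothesis co_nd : coprime n d.
Hypothesis eq_y : y ^+ n = ratfun F f.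
Hypothesis gen_y : <<1%VS; y>>%VS = fullv.
Hypothesis oo_x : oo (xcoord F) < 0.
Implicit Types (P Q : place F).

Lemma natr_neq0_gt0 : (0 < n)%N.
Proof. by case: n n_neq0 => //; rewrite eqxx. Qed.

Lemma curve_f_neq0 : f != 0.
Proof. by rewrite -size_poly_eq0 size_f. Qed.

Lemma polyfun_inj0 (p : {poly {poly K}}) : (size p <= n)%N ->
  (polyfun y p == 0) = (p == 0).
Proof. exact: (polyfun_eq0 natr_neq0_gt0 eq_y size_f co_nd oo_x). Qed.

(** The ramification index of x at an affine point with ordinate b. *)
Definition ramif (b : K) : nat := if b == 0 then n else 1%N.

(** If b = 0, then y is a parameter: y^n = f1(x)(x - a) with f1(a) nonzero, a being a simple root of
    f. Otherwise x - a is one: the sum [s] of the y^(n-1-i) b^i satisfies s (y - b) = f(x) - f(a), a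
    multiple of x - a, and takes the value n b^(n-1), nonzero, at the point. *)
Lemma exists_local_param a b : b ^+ n = f.[a] -> exists t s u0 v0,
  [/\ bieval a b t = 0, bieval a b s != 0, bieval a b u0 != 0,
   polyfun y s * (xcoord F - cst F a) = polyfun y t ^+ ramif b * polyfun y u0
   & polyfun y s * (y - cst F b) = polyfun y t * polyfun y v0].
Proof.
rewrite /ramif; have [-> |b0] := eqVneq b 0 => on_curve.
  have fa : root f a by rewrite /root -on_curve expr0n gtn_eqF ?natr_neq0_gt0.
  have [f1 ef f1a] := distinct_roots_root f_roots curve_f_neq0 fa.
  exists 'X, f1%:P, 1, f1%:P; split;
    rewrite ?bieval1 ?oner_eq0 ?bievalX ?bievalC //.
    by rewrite polyfun1 polyfunC polyfunX mulr1 eq_y ef ratfunM ratfun_XsubC.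
  by rewrite polyfunX cst0 subr0 mulrC.
have /factor_theorem[q eq] : root (f - f.[a]%:P) a
  by rewrite /root !hornerE subrr.
pose s : {poly {poly K}} := \sum_(i < n) 'X^(n.-1 - i) * b%:P%:P ^+ i.
have s0 : bieval a b s != 0.
  rewrite /bieval horner_sum (eq_bigr (fun _ => (b ^+ n.-1)%:P)).
    by rewrite sumr_const card_ord hornerMn hornerC -mulr_natr mulf_neq0
      ?expf_neq0.
  move=> i _; rewrite !hornerE -exprD subnK ?rmorphXn //.
  by rewrite -ltnS prednK ?natr_neq0_gt0.
exists ('X - a%:P)%:P, s, s, q%:P; split=> //.
- by rewrite bievalC !hornerE subrr.
- by rewrite expr1 mulrC polyfunC ratfun_XsubC.
transitivity (y ^+ n - cst F (b ^+ n)).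
  have -> : y - cst F b = polyfun y ('X - b%:P%:P)
    by rewrite polyfunB polyfunX polyfunC.
  rewrite mulrC -polyfunM -subrXX polyfunB !polyfunXn polyfunX polyfunC ratfunC.
  by rewrite cstXn.
by rewrite on_curve eq_y -ratfunC -ratfunB eq !polyfunC mulrC ratfunM.
Qed.

Lemma ramif_gt0 b : (0 < ramif b)%N.
Proof. by rewrite /ramif; case: eqP => // _; apply: natr_neq0_gt0. Qed.

Lemma point_place a b : b ^+ n = f.[a] -> exists P, centered y a b P.
Proof.
move=> on_curve; have [t [s [u0 [v0 [? ? ? e1 e2]]]]] :=
  exists_local_param on_curve.
exact: (place_exists natr_neq0_gt0 eq_y gen_y polyfun_inj0 on_curve (ramif_gt0
  b) _ _ _ e1 e2).
Qed.

Lemma point_unique a b P Q : b ^+ n = f.[a] ->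
  centered y a b P -> centered y a b Q -> P = Q.
Proof.
move=> on_curve; have [t [s [u0 [v0 [? ? ? e1 e2]]]]] :=
  exists_local_param on_curve.
exact: (centered_unique natr_neq0_gt0 eq_y gen_y polyfun_inj0 on_curve
  (ramif_gt0 b) _ _ _ e1 e2).
Qed.

Lemma point_ramif a b P : b ^+ n = f.[a] -> centered y a b P ->
  P (xcoord F - cst F a) = (ramif b)%:Z.
Proof.
move=> on_curve; have [t [s [u0 [v0 [? ? ? e1 e2]]]]] :=
  exists_local_param on_curve.
exact: (centered_ramif natr_neq0_gt0 eq_y gen_y polyfun_inj0 on_curve
  (ramif_gt0 b) _ _ _ e1 e2).
Qed.

Lemma point_residue a b P h : b ^+ n = f.[a] -> centered y a b P -> vge P 0 h ->
  exists c, vge P 1 (h - cst F c).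
Proof.
move=> on_curve; have [t [s [u0 [v0 [? ? ? e1 e2]]]]] :=
  exists_local_param on_curve.
exact: (centered_residue natr_neq0_gt0 eq_y gen_y polyfun_inj0 on_curve
  (ramif_gt0 b) _ _ _ e1 e2).
Qed.

Lemma ord_prod0 P (I : Type) (r : seq I) (E : I -> F) :
  (forall i, E i != 0 /\ P (E i) = 0) ->
  \prod_(i <- r) E i != 0 /\ P (\prod_(i <- r) E i) = 0.
Proof.
move=> E0; elim/big_ind: _ => [|u v [u0 Pu] [v0 Pv]|i _]; last exact: E0.
  by rewrite oner_neq0 ord1.
by rewrite mulf_neq0 // ord_atM // Pu Pv.
Qed.

Lemma vge_ratfun P p : vge P 0 (xcoord F) -> vge P 0 (ratfun F p).
Proof.
move=> Px; rewrite ratfun_sum; apply: vge_sum => i _.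
by apply: vgeM0; [exact: vge_cst | exact: vgeX].
Qed.

Lemma vge_root P h m : (0 < m)%N -> vge P 0 (h ^+ m) -> vge P 0 h.
Proof.
move=> m0; rewrite /vge expf_eq0 m0 /= ordX.
by case: eqP => //= _; rewrite pmulrn_lge0.
Qed.

(** If no x - a vanished at P, all nonzero polynomials in x would have order 0. Every function,
    being a polynomial in x and y over one in x, would then have nonnegative order, against the
    inverse of a uniformizer. *)
Lemma place_x_center P : vge P 0 (xcoord F) ->
  exists a, vge P 1 (xcoord F - cst F a).
Proof.
move=> Px; apply: contrapT => /forallNP noa.
have P0 a : xcoord F - cst F a != 0 /\ P (xcoord F - cst F a) = 0.
  have xa0 : xcoord F - cst F a != 0.
    by rewrite -ratfun_XsubC ratfun_eq0 polyXsubC_eq0.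
  split=> //; have /negP := noa a; rewrite vge_neq0 // -ltNge.
  have := vge_ratfun ('X - a%:P) Px; rewrite ratfun_XsubC vge_neq0 //; lia.
have Pr p : p != 0 -> P (ratfun F p) = 0.
  move=> p0; have [rs ->] := closed_field_poly_normal p.
  rewrite -mul_polyC ratfunM ratfunC rmorph_prod /=.
  rewrite (eq_bigr (fun z => xcoord F - cst F z)) => [|z _]; last first.
    exact: ratfun_XsubC.
  have [r0 Pr] := ord_prod0 rs P0.
  by rewrite ord_atM ?Pr ?ord_at_cst // cst_eq0 lead_coef_eq0.
have Py : vge P 0 y.
  by apply: (vge_root natr_neq0_gt0); rewrite eq_y; apply: vge_ratfun.
have [w Pw] := ord_at_uniformizer P.
have w0 : w != 0 by apply: contra_eqN Pw => /eqP->; rewrite ord_at0.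
have [R R0 [p _ eR]] := curve_frac natr_neq0_gt0 eq_y gen_y w^-1.
have RF0 : ratfun F R != 0 by rewrite ratfun_eq0.
have := vge_polyfun p Px Py; rewrite -eR vge_neq0 ?mulf_neq0 ?invr_eq0 //.
by rewrite ord_atM ?invr_eq0 // Pr // ordV Pw.
Qed.

(** With x centered at a, the function y^n - f(a) vanishes at P. It is the product of the y - z over
    the roots z of X^n - f(a), so some factor vanishes. *)
Lemma place_center P : 0 <= P (xcoord F) ->
  exists a b, b ^+ n = f.[a] /\ centered y a b P.
Proof.
move=> Px0; have Px : vge P 0 (xcoord F) by rewrite /vge Px0 orbT.
have [a Pa] := place_x_center Px; exists a.
have /factor_theorem[q eq] : root (f - f.[a]%:P) a
  by rewrite /root !hornerE subrr.
have Py : vge P 0 y.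
  by apply: (vge_root natr_neq0_gt0); rewrite eq_y; apply: vge_ratfun.
have Pyn : vge P 1 (y ^+ n - cst F f.[a]).
  rewrite eq_y -ratfunC -ratfunB eq ratfunM ratfun_XsubC.
  by apply: vgeM0l => //; apply: vge_ratfun.
have [rs ers] := closed_field_poly_normal ('X^n - f.[a]%:P).
rewrite (eqP (monicXnsubC _ natr_neq0_gt0)) scale1r in ers.
have eyn : y ^+ n - cst F f.[a] = \prod_(z <- rs) (y - cst F z).
  have := congr1 (fun p : {poly K} => (map_poly (cst F) p).[y]) ers.
  rewrite rmorphB /= map_polyXn map_polyC hornerD hornerN hornerXn hornerC =>
    ->.
  rewrite map_prod_XsubC horner_prod; apply: eq_bigr => z _.
  by rewrite hornerXsubC.
have [b b_rs Pb] : exists2 b, b \in rs & vge P 1 (y - cst F b).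
  apply: contrapT => /forall2NP nob.
  suff [p0 Pp] : \prod_(z <- rs) (y - cst F z) != 0 /\
    P (\prod_(z <- rs) (y - cst F z)) = 0.
    by move: Pyn; rewrite eyn vge_neq0 // Pp.
  rewrite big_seq; elim/big_ind: _ => [|u v [u0 Pu] [v0 Pv]|z z_rs].
  - by rewrite oner_neq0 ord1.
  - by rewrite mulf_neq0 // ord_atM // Pu Pv.
  have [//|/negP] := nob z; rewrite /vge negb_or -ltNge => /andP[yz0 Pyz].
  split=> //; have : vge P 0 (y - cst F z) by rewrite vgeD ?vgeN ?vge_cst.
  by rewrite vge_neq0 //; lia.
exists b; rewrite /centered Pa Pb; split=> //; apply/eqP.
by rewrite -subr_eq0; move: b_rs; rewrite -root_prod_XsubC -ers /root !hornerE.
Qed.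

(** Either f(a) = 0 and the only point is (a, 0), of index n, or there are n points (a, b), each of
    index 1. *)
Lemma places_above a : exists T : seq (place F),
  [/\ uniq T, forall P, (P \in T) = (0 < P (xcoord F - cst F a)) &
   \sum_(P <- T) P (xcoord F - cst F a) <= n%:Z].
Proof.
have ex_pl b : exists P, b ^+ n = f.[a] -> centered y a b P.
  have [e|ne] := eqVneq (b ^+ n) f.[a]; first by have [P cP] := point_place e;
    exists P.
  (* [oo] is a dummy value for the b that give no point above a. *)
  by exists oo => /eqP; rewrite (negPf ne).
have [pl plP] := choice ex_pl.
have [rs [uniq_rs rsE sum_rs]] : exists rs : seq K, [/\ uniq rs,
    forall b, (b \in rs) = (b ^+ n == f.[a]) & (\sum_(b <- rs) ramif b <= n)%N].
  have [fa|fa] := eqVneq f.[a] 0.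
    exists [:: 0]; split=> // [b|]; last by rewrite big_seq1 /ramif eqxx.
    by rewrite fa inE expf_eq0 natr_neq0_gt0.
  have [rs [uniq_rs size_rs rsE]] := uniq_nth_roots n_neq0 fa.
  exists rs; split=> //; rewrite -[X in (_ <= X)%N]size_rs -sum1_size.
  rewrite big_seq [X in (_ <= X)%N]big_seq; apply: leq_sum => b.
  rewrite rsE /ramif; case: (eqVneq b 0) => // -> /eqP e.
  by move: fa; rewrite -e expr0n gtn_eqF ?natr_neq0_gt0 ?eqxx.
exists (map pl rs); split.
- rewrite map_inj_in_uniq // => b b';
  rewrite !rsE => /eqP/plP cb /eqP/plP cb' e.
  rewrite -e in cb'; case/andP: cb => _ yb; case/andP: cb' => _ yb'.
  (* Two ordinates at one place would make the constant b' - b vanish there. *)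
  have : vge (pl b) 1 (cst F (b' - b)).
    have -> : cst F (b' - b) = (y - cst F b) - (y - cst F b') by rewrite cstB;
      ring.
    by rewrite vgeD ?vgeN.
  by move/vge_gt0_cst/eqP; rewrite subr_eq0 => /eqP.
- move=> P; apply/mapP/idP => [[b]|Pa].
    rewrite rsE => /eqP on_c ->; rewrite (point_ramif on_c (plP _ on_c))
      ltz_nat.
    exact: ramif_gt0.
  have Pa1 : vge P 1 (xcoord F - cst F a) by rewrite /vge gtz0_ge1 in Pa *;
    rewrite Pa orbT.
  have Px : 0 <= P (xcoord F).
    have : vge P 0 (xcoord F).
      rewrite -(subrK (cst F a) (xcoord F)).
      by rewrite vgeD ?vge_cst // (vge_le _ Pa1).
    by rewrite /vge => /orP[/eqP->|//]; rewrite ord_at0.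
  have [a' [b [on_c cP]]] := place_center Px.
  have ea : a' = a.
    have /andP[Pa' _] := cP.
    have : vge P 1 (cst F (a' - a)).
      have -> : cst F (a' - a) = (xcoord F - cst F a) - (xcoord F - cst F a').
        by rewrite cstB; ring.
      by rewrite vgeD ?vgeN.
    by move/vge_gt0_cst/eqP; rewrite subr_eq0 => /eqP.
  rewrite ea in on_c cP; exists b; first by rewrite rsE on_c.
  exact: (point_unique on_c cP (plP b on_c)).
rewrite big_map big_seq (eq_bigr (fun b => (ramif b)%:Z)); last first.
  by move=> b; rewrite rsE => /eqP on_c; apply: point_ramif (plP _ on_c).
by rewrite -big_seq -(big_morph Posz PoszD (erefl (Posz 0))) lez_nat.
Qed.

End Places.

(** * Counting monomials *)

Section MonomialCount.

Variables n d : nat.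
Hypothesis n_gt0 : (0 < n)%N.
Hypothesis co_nd : coprime n d.

Lemma sum_ord_double m : 2 * \sum_(i < m) (i : nat)%:Z = m%:Z * (m%:Z - 1).
Proof.
elim: m => [|m IHm]; first by rewrite big_ord0.
by rewrite big_ord_recr /= mulrDr IHm; lia.
Qed.

(* As d is a unit modulo n, the n remainders are 0, ..., n-1 in some order.   *)
Lemma sum_divz_affine (M : int) :
  2 * \sum_(j < n) (((M - (d * j)%N%:Z) %/ n%:Z)%Z + 1) =
  2 * (M + 1) - (n%:Z - 1) * (d%:Z - 1).
Proof.
have n0 : n%:Z != 0 by lia.
have rem_lt (j : 'I_n) : (absz ((M - (d * j)%N%:Z) %% n%:Z)%Z < n)%N.
  have := ltz_mod (M - (d * j)%N%:Z) n0; have := modz_ge0 (M - (d * j)%N%:Z) n0.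
  by lia.
pose r (j : 'I_n) := Ordinal (rem_lt j).
have rE j : (r j : nat)%:Z = ((M - (d * j)%N%:Z) %% n%:Z)%Z.
  by rewrite /= gez0_abs // modz_ge0.
have r_inj : injective r.
  move=> i j /(congr1 (fun k : 'I_n => (k : nat)%:Z)); rewrite !rE => e.
  have ei := divz_eq (M - (d * i)%N%:Z) n;
    have ej := divz_eq (M - (d * j)%N%:Z) n.
  apply/val_inj; rewrite e in ei.
  set u := (_ %/ _)%Z in ei; set v := (_ %/ _)%Z in ej.
  have euv : d%:Z * (j%:Z - i%:Z) = n%:Z * (u - v).
    rewrite !mulrBr -!PoszM ![n%:Z * _]mulrC.
    by move: ei ej; set mm := (_ %% _)%Z; lia.
  have : (n%:Z %| j%:Z - i%:Z)%Z.
    rewrite -(@Gauss_dvdzr _ d%:Z) //; apply/dvdzP; exists (u - v).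
    by rewrite euv mulrC.
  rewrite -eqz_mod_dvd => /eqP; rewrite !modz_small => [[]//||]; exact: ltn_ord.
have sum_r : \sum_(j < n) ((M - (d * j)%N%:Z) %% n%:Z)%Z =
  \sum_(j < n) (j : nat)%:Z.
  by rewrite [RHS](reindex_inj r_inj) /=; apply: eq_bigr => j _; rewrite -rE.
have sum_j := sum_ord_double n.
have : \sum_(j < n) (M - (d * j)%N%:Z) =
    (\sum_(j < n) ((M - (d * j)%N%:Z) %/ n%:Z)%Z) * n%:Z +
    \sum_(j < n) ((M - (d * j)%N%:Z) %% n%:Z)%Z.
  rewrite mulr_suml -big_split /=; apply: eq_bigr => j _; exact: divz_eq.
rewrite sum_r big_split /= [\sum_(j < n) - _]sumrN sumr_const card_ord intMrn.
rewrite (eq_bigr (fun j : 'I_n => d%:Z * (j : nat)%:Z)); last by move=> j _;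
  rewrite PoszM.
rewrite -mulr_sumr big_split /= sumr_const card_ord intMrn.
move: sum_j; set S := \sum_(j < n) (j : nat)%:Z;
  set T := \sum_(j < n) _ => eS eT.
by apply: (mulIf n0); nia.
Qed.

(** The pole order at infinity of the monomial with index m, see [ord_infty_monom]. *)
Definition mdeg (m : 'I_n * nat) : nat := (n * m.2 + d * m.1)%N.

(** The number of i with ni + dj <= M; the test guards against truncated subtraction. *)
Definition row_size (M j : nat) : nat :=
  if (d * j <= M)%N then ((M - d * j) %/ n).+1 else 0%N.

Definition small_monoms (M : nat) : seq ('I_n * nat) :=
  [seq (j, i) | j : 'I_n <- enum 'I_n, i : nat <- iota 0 (row_size M j)].

Lemma ltn_row_size M j i : (i < row_size M j)%N = (n * i + d * j <= M)%N.
Proof.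
rewrite /row_size; case: (leqP (d * j) M) => le_jM.
  by rewrite ltnS leq_divRL // [in RHS]mulnC addnC leq_subRL.
by rewrite ltn0 leqNgt (leq_trans le_jM) ?leq_addl.
Qed.

Lemma mem_small_monoms M m : (m \in small_monoms M) = (mdeg m <= M)%N.
Proof.
case: m => j i; apply/allpairsPdep/idP => [[j' [i' [_ i'_lt [-> ->]]]]|le_M].
  by rewrite mem_iota add0n ltn_row_size in i'_lt.
by exists j, i; rewrite mem_enum mem_iota /= add0n ltn_row_size.
Qed.

Lemma uniq_small_monoms M : uniq (small_monoms M).
Proof.
apply: allpairs_uniq_dep; first exact: enum_uniq.
  by move=> j _; apply: iota_uniq.
by move=> [j i] [j' i'] _ _ /= [-> ->].
Qed.

Lemma mdeg_inj : injective mdeg.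
Proof.
move=> [j i] [j' i'] /= e; have ej : j = j'.
  exact/val_inj/(coprime_affine_inj co_nd (ltn_ord j) (ltn_ord j') e).
by move: e; rewrite /mdeg ej /= => e; congr (_, _); nia.
Qed.

Lemma size_small_monoms M :
  (size (small_monoms M))%:Z = \sum_(j < n) (row_size M j)%:Z.
Proof.
rewrite size_allpairs_dep sumnE big_map -big_enum /= -(big_morph Posz PoszD
  (erefl (Posz 0))).
by congr Posz; apply: eq_bigr => j _; rewrite size_iota.
Qed.

(** Equality holds if dj <= M; otherwise the row is empty while the floor is negative. *)
Lemma row_size_ge (M : nat) j : ((M%:Z - (d * j)%N%:Z) %/ n%:Z)%Z + 1 <=
  (row_size M j)%:Z.
Proof.
rewrite /row_size; case: (leqP (d * j) M) => le_jM.
  by rewrite subzn // divz_nat; lia.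
have : ((M%:Z - (d * j)%N%:Z) %/ n%:Z)%Z < 0 by rewrite ltz_divLR ?mul0r; lia.
by lia.
Qed.

(** For M < dj <= M + n the floor is exactly -1, so the formula still counts an empty row as 0. *)
Lemma row_size_eq (M : nat) j : (d * j <= M + n)%N ->
  (row_size M j)%:Z = ((M%:Z - (d * j)%N%:Z) %/ n%:Z)%Z + 1.
Proof.
move=> le_jMn; apply/eqP; rewrite eq_le row_size_ge andbT.
rewrite /row_size; case: (leqP (d * j) M) => le_jM;
  first by rewrite subzn // divz_nat; lia.
have : -1 <= ((M%:Z - (d * j)%N%:Z) %/ n%:Z)%Z by rewrite lez_divRL; lia.
by lia.
Qed.

Lemma size_small_monoms_ge M :
  2 * (M%:Z + 1) - (n%:Z - 1) * (d%:Z - 1) <= 2 * (size (small_monoms M))%:Z.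
Proof.
rewrite -sum_divz_affine size_small_monoms ler_pM2l //.
by apply: ler_sum => j _; apply: row_size_ge.
Qed.

Lemma size_small_monoms_eq (M : nat) : (d * n.-1 <= M + n)%N ->
  2 * (size (small_monoms M))%:Z = 2 * (M%:Z + 1) - (n%:Z - 1) * (d%:Z - 1).
Proof.
move=> le_M; rewrite -sum_divz_affine size_small_monoms; congr (_ * _).
apply: eq_bigr => j _; apply: row_size_eq; apply: leq_trans le_M.
by rewrite leq_mul2l -ltnS prednK // ltn_ord orbT.
Qed.

End MonomialCount.

(** * Functions regular away from infinity *)

Section MonomialBasis.

Variables (K : closedFieldType) (F : fieldExtType {fraction {poly K}}).
Variables (n d : nat) (f : {poly K}) (y : F) (oo : place F).
Hypothesis n_neq0 : n%:R != 0 :> K.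
Hypothesis f_roots : distinct_roots f.
Hypothesis size_f : size f = d.+1.
Hypothesis co_nd : coprime n d.
Hypothesis eq_y : y ^+ n = ratfun F f.
Hypothesis gen_y : <<1%VS; y>>%VS = fullv.
Hypothesis oo_x : oo (xcoord F) < 0.
Implicit Types (P Q : place F).

Let n0 : (0 < n)%N := natr_neq0_gt0 n_neq0.

Lemma place_finite P : P != oo -> 0 <= P (xcoord F).
Proof.
move=> Poo; rewrite leNgt; apply: contra Poo => Px; apply/eqP.
exact: (infty_unique n0 eq_y gen_y size_f co_nd Px oo_x).
Qed.

Lemma centered_neq_infty a b P : centered y a b P -> P != oo.
Proof.
move/centered_x => Px; apply: contraTneq oo_x => <-; rewrite -leNgt.
by move: Px; rewrite /vge => /orP[/eqP->|//]; rewrite ord_at0.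
Qed.

Lemma ord_infty_monom (m : 'I_n * nat) : oo (monom y m) = - (mdeg d m)%:Z.
Proof.
have [Px Py] := infty_ord n0 eq_y gen_y size_f co_nd oo_x.
have x0 : xcoord F != 0 by apply: contraTneq oo_x => ->; rewrite ord_at0.
have y0 := curve_y_neq0 n0 eq_y size_f.
rewrite /monom ord_atM ?expf_neq0 // !ordX Px Py !intMrn /mdeg; lia.
Qed.

Lemma monom_neq0 (m : 'I_n * nat) : monom y m != 0.
Proof.
have x0 : xcoord F != 0 by apply: contraTneq oo_x => ->; rewrite ord_at0.
by rewrite mulf_neq0 ?expf_neq0 // (curve_y_neq0 n0 eq_y size_f).
Qed.

Lemma vge_monom P (m : 'I_n * nat) : P != oo -> 0 <= P (monom y m).
Proof.
move=> /place_finite Px; have Px' : vge P 0 (xcoord F) by rewrite /vge Px orbT.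
have Py : vge P 0 y.
  by apply: (vge_root n0); rewrite eq_y; apply: vge_ratfun.
rewrite -(vge_neq0 P 0 (monom_neq0 m)); apply: vgeM0; exact: vgeX.
Qed.

(* At the n points above [a] with f(a) <> 0 the values of [p] are those of a  *)
(* polynomial in y of degree < n; above a root [a] of f the terms of [p] have *)
(* valuations that are distinct modulo n.                                     *)
Lemma dvd_of_centered_vge a (p : {poly {poly K}}) : (size p <= n)%N ->
    (forall b P, b ^+ n = f.[a] -> centered y a b P ->
       vge P (ramif n b)%:Z (polyfun y p)) ->
  forall j, root p`_j a.
Proof.
move=> le_pn Pp; have [fa|fa] := eqVneq f.[a] 0; last first.
  have [rs [uniq_rs size_rs rsE]] := uniq_nth_roots n_neq0 fa.
  pose q := map_poly (horner_eval a) p.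
  have q0 : q = 0.
    apply/eqP; apply: contraTT le_pn => q0; rewrite -ltnNge.
    have le_q : (size q <= size p)%N by apply: size_poly.
    apply: leq_trans le_q; rewrite -size_rs; apply: max_poly_roots => //.
    apply/allP => b; rewrite rsE => /eqP on_c.
    have b0 : b != 0 by apply: contraNneq fa => e;
      rewrite -on_c e expr0n gtn_eqF.
    have [P cP] := point_place n_neq0 f_roots size_f co_nd eq_y gen_y oo_x on_c.
    have := Pp b P on_c cP; rewrite /ramif (negPf b0) => Pp1.
    have -> : root q b = (bieval a b p == 0).
      have eb : horner_eval a b%:P = b by rewrite /horner_eval hornerC.
      by rewrite /root /q -[X in _.[X]]eb horner_map.
    apply: contraTT Pp1 => pn0; have [pp0 eP] := centered_bieval cP pn0.
    by rewrite vge_neq0 // eP.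
  by move=> j; rewrite /root -/(horner_eval a _) -coef_map -/q q0 coef0.
move=> j; have on_c : 0 ^+ n = f.[a] by rewrite expr0n gtn_eqF // fa.
have [P cP] := point_place n_neq0 f_roots size_f co_nd eq_y gen_y oo_x on_c.
have Px := point_ramif n_neq0 f_roots size_f co_nd eq_y gen_y oo_x on_c cP.
have := Pp 0 P on_c cP; move: Px; rewrite /ramif eqxx => Px Pp0.
have y0 := curve_y_neq0 n0 eq_y size_f.
have Pr (q : {poly K}) : q.[a] != 0 -> P (ratfun F q) = 0.
  move=> qa; rewrite -(polyfunC y).
  by have [|_ ->] := @centered_bieval _ _ _ a 0 P q%:P cP; rewrite ?bievalC.
have Prat (q : {poly K}) : q != 0 -> exists m : nat,
    P (ratfun F q) = (n * m)%N%:Z /\ (~~ root q a -> m = 0%N).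
  move=> q0; have [m [q' q'a eq]] := multiplicity_XsubC q a;
    rewrite q0 /= in q'a.
  exists m; split; last first.
    by rewrite {1}eq rootM negb_or q'a /=; case: m {eq} => // m;
      rewrite root_exp_XsubC eqxx.
  have q'0 : q' != 0 by apply: contraNneq q'a => ->; rewrite root0.
  have xa0 : ('X - a%:P) ^+ m != 0 by rewrite expf_neq0 ?polyXsubC_eq0.
  rewrite eq ratfunM ord_atM ?ratfun_eq0 // Pr // add0r.
  by rewrite [ratfun F (_ ^+ m)]rmorphXn /= ratfun_XsubC ordX Px intMrn PoszM.
have Py : P y = 1.
  have f0 := curve_f_neq0 size_f.
  have fr : root f a by apply/eqP.
  have [f1 ef f1a] := distinct_roots_root f_roots f0 fr.
  have := congr1 P eq_y; rewrite ordX {1}ef ratfunM ratfun_XsubC ord_atM.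
  - by rewrite Pr // Px intMrn; nia.
  - by rewrite ratfun_eq0; apply: contraNneq f1a => ->; rewrite horner0.
  - by rewrite -ratfun_XsubC ratfun_eq0 polyXsubC_eq0.
have [le_nj|lt_jn] := leqP n j; first
  by rewrite nth_default ?root0 // (leq_trans le_pn).
apply: contraTT Pp0 => pj; rewrite (polyfun_sum y le_pn).
pose E (i : 'I_n) := ratfun F p`_i * y ^+ i.
have E0 i : (E i != 0) = (p`_i != 0).
  by rewrite mulf_eq0 expf_eq0 (negPf y0) andbF orbF ratfun_eq0.
have PE i : E i != 0 -> exists m : nat, P (E i) = (n * m + i)%N%:Z /\
    (~~ root p`_i a -> m = 0%N).
  move=> Ei; have pi0 : p`_i != 0 by rewrite -E0.
  have [m [em m0]] := Prat _ pi0; exists m; split=> //.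
  by rewrite ord_atM ?ratfun_eq0 ?expf_neq0 // em ordX Py intMrn mul1r PoszD.
have pj0 : p`_j != 0 by apply: contraNneq pj => ->; rewrite root0.
have Ej : E (Ordinal lt_jn) != 0 by rewrite E0.
have [|sum0 [i [Ei eqE minE]]] := ord_sum_distinct Ej (P := P).
  move=> i i' /PE[m [-> _]] /PE[m' [-> _]] [e]; apply/val_inj.
  apply: (@coprime_affine_inj n 1 m m' _ _ (coprimen1 n) (ltn_ord i) (ltn_ord
    i')).
  by rewrite !mul1n.
rewrite vge_neq0 // -ltNge; have := minE (Ordinal lt_jn); rewrite vge_neq0 //.
have [m [-> m0]] := PE _ Ej; rewrite m0 //= muln0 add0n => le_j.
by apply: le_lt_trans le_j _.
Qed.

(** Induction on the degree of a denominator R(x) of h. At a root a of R, the numerator is divisible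
    by x - a by [dvd_of_centered_vge], and this factor cancels. *)
Lemma finite_integral (h : F) : (forall P, P != oo -> vge P 0 h) ->
  exists2 p : {poly {poly K}}, (size p <= n)%N & h = polyfun y p.
Proof.
move=> Ph; have [R R0 [p le_pn eR]] := curve_frac n0 eq_y gen_y h.
have [N le_N] := ubnP (size R); elim: N => // N IH in R R0 p le_pn eR le_N *.
have [sR|sR] := eqVneq (size R) 1%N.
  have /size_poly1P[c c0 eRc] := introT eqP sR.
  exists (c^-1%:P *: p); first by rewrite (leq_trans (size_scale_leq _ _)).
  rewrite -mul_polyC polyfunM -eR eRc polyfunC mulrA -ratfunM -polyCM mulVf //.
  by rewrite -[_%:P]/(1%:P) ratfunC -[cst F 1]/(cst F 1) rmorph1 mul1r.
have /closed_rootP[a /factor_theorem[R' eR']] := sR.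
have R'0 : R' != 0 by apply: contraNneq R0 => R'0; rewrite eR' R'0 mul0r.
(* The numerator is R h = R'(x)(x - a)h with R' and h regular, so its order above a is at least that
   of x - a. *)
have root_p j : root p`_j a.
  apply: dvd_of_centered_vge => // b P on_c cP; rewrite -eR eR' ratfunM -mulrA.
  have Px := point_ramif n_neq0 f_roots size_f co_nd eq_y gen_y oo_x on_c cP.
  apply: vgeM0l; last by apply/vge_ratfun/(centered_x cP).
  apply: vgeM0; last exact/Ph/(centered_neq_infty cP).
  by rewrite ratfun_XsubC /vge Px lexx orbT.
have ex_q j : exists q, p`_j = q * ('X - a%:P).
  by have /factor_theorem[q eq] := root_p j; exists q.
have [q qE] := choice ex_q.
apply: (IH R' R'0 (\poly_(j < n) q j)); first exact: size_poly.
  have xa0 : ratfun F ('X - a%:P) != 0 by rewrite ratfun_eq0 polyXsubC_eq0.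
  apply: (mulfI xa0); rewrite mulrA -ratfunM [_ * R']mulrC -eR' eR.
  rewrite (polyfun_sum y le_pn) (polyfun_sum y (size_poly n q)) mulr_sumr.
  apply: eq_bigr => j _; rewrite coef_poly ltn_ord qE ratfunM.
  by rewrite mulrA [ratfun F (q j) * _]mulrC.
move: le_N; rewrite eR' size_Mmonic ?monicXsubC // size_XsubC addn2 /=.
by rewrite ltnS.
Qed.

End MonomialBasis.

(** * Dimensions and the genus *)

Section Independence.

Variables (K : closedFieldType) (F : fieldExtType {fraction {poly K}}).
Implicit Types (P Q : place F).

Definition indep r (b : 'I_r -> F) := forall c : 'I_r -> K,
  \sum_i cst F (c i) * b i = 0 -> forall i, c i = 0.

Lemma indep_ord_inj P r (b : 'I_r -> F) :
  (forall i, b i != 0) -> injective (fun i => P (b i)) -> indep b.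
Proof.
move=> b0 inj_b c sum0 i; apply/eqP; apply: contra_eqT sum0 => ci.
have E0 j : cst F (c j) * b j != 0 -> P (cst F (c j) * b j) = P (b j).
  rewrite mulf_eq0 negb_or => /andP[cj bj].
  by rewrite ord_atM // ord_at_cst add0r.
have Ei : cst F (c i) * b i != 0 by rewrite mulf_neq0 ?b0 ?cst_eq0.
have [|//] := @ord_sum_distinct _ _ P _ (fun j => cst F (c j) * b j) i Ei.
by move=> j k /E0-> /E0->; apply: inj_b.
Qed.

(** If r > l, the r by l coefficient matrix has a nonzero left kernel vector, which is a relation
    among the b i. *)
Lemma indep_le_span r l (b : 'I_r -> F) (v : 'I_l -> F) : indep b ->
  (forall i, exists c : 'I_l -> K, b i = \sum_j cst F (c j) * v j) ->
    (r <= l)%N.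
Proof.
move=> indep_b /choice[c cE]; pose A := \matrix_(i < r, j < l) c i j.
apply: contraT; rewrite -ltnNge => lt_lr.
have : kermx A != 0.
  rewrite kermx_eq0 /row_free neq_ltn; apply/orP; left.
  by apply: leq_ltn_trans lt_lr; apply: rank_leq_col.
case/rowV0Pn => w /sub_kermxP wA w0; case/negP: w0.
apply/eqP/rowP => i; rewrite mxE; move: i; apply: indep_b.
rewrite (eq_bigr (fun i => \sum_j cst F (w 0 i * c i j) * v j)); last first.
  by move=> i _; rewrite cE mulr_sumr; apply: eq_bigr => j _;
    rewrite cstM mulrA.
rewrite exchange_big big1 //= => j _; rewrite -mulr_suml -rmorph_sum /=.
have := congr1 (fun B : 'rV_l => B 0 j) wA; rewrite !mxE => wAj.
by rewrite (eq_bigr (fun i => w 0 i * A i j)) ?wAj ?cst0 ?mul0r // => i _;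
  rewrite mxE.
Qed.

(** The residue field at P is K. *)
Definition has_residues P := forall h, vge P 0 h ->
  exists c, vge P 1 (h - cst F c).

(** Raising the order at P by one costs at most one dimension: a multiple of one function of order
    exactly z is subtracted from each other one. The new functions are K-combinations of the old, so
    a lower bound shared by all old functions at any place persists. *)
Lemma codim_step P (z : int) r (b : 'I_r.+1 -> F) : has_residues P ->
    indep b -> (forall i, vge P z (b i)) ->
  exists b' : 'I_r -> F, [/\ indep b', forall i, vge P (z + 1) (b' i) &
    forall Q w, (forall i, vge Q w (b i)) -> forall i, vge Q w (b' i)].
Proof.
move=> resP indep_b Pb.
have [i0 [c cP]] : exists i0 (c : 'I_r.+1 -> K), forall i, i != i0 ->
    vge P (z + 1) (b i - cst F (c i) * b i0).
  (* If all orders already exceed z, any function may be dropped, with zero corrections; otherwise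
     the pivot [i0] has order exactly z. *)
  have [/forallP all_gt|/forallPn[i0 Pi0]] :=
    boolP [forall i, vge P (z + 1) (b i)].
    by exists ord0, (fun => 0) => i _; rewrite cst0 mul0r subr0.
  have b0 : b i0 != 0 by apply: contraNneq Pi0 => ->; apply: vge0.
  have Pbz : P (b i0) = z.
    by have := Pb i0; move: Pi0; rewrite !vge_neq0 //; lia.
  have ex_c i : exists c, vge P 1 (b i / b i0 - cst F c).
    apply: resP; rewrite -(subrr z); apply: vgeM => //.
    by rewrite vge_neq0 ?invr_eq0 // ordV Pbz.
  have [c cE] := choice ex_c; exists i0, c => i _.
  have -> : b i - cst F (c i) * b i0 = b i0 * (b i / b i0 - cst F (c i))
    by field.
  by apply: vgeM => //; rewrite Pbz.
exists (fun i => b (fintype.lift i0 i) - cst F (c (fintype.lift i0 i)) * b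
  i0); split.
(* A relation among the new functions yields one among the old, the coefficient at [i0] collecting
   the corrections. *)
- move=> e sum_e i; pose e' j := if unlift i0 j is Some k then e k else
    - \sum_k e k * c (fintype.lift i0 k).
  have := indep_b e' _ (fintype.lift i0 i); rewrite /e' liftK; apply.
  rewrite (bigD1_ord i0) //= /e' unlift_none.
  rewrite (eq_bigr (fun k => cst F (e k) * b (fintype.lift i0 k)));
    last by move=> k _; rewrite liftK.
  move: sum_e; rewrite (eq_bigr (fun k => cst F (e k) * b (fintype.lift i0 k) -
    cst F (e k * c (fintype.lift i0 k)) * b i0)); last first.
    by move=> k _; rewrite cstM; ring.
  by rewrite sumrB -mulr_suml -rmorph_sum /= rmorphN /= mulNr addrC.
- by move=> i; apply: cP; rewrite eq_sym neq_lift.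
move=> Q w Qb i; apply: vgeD => //; rewrite vgeN; apply: vgeM0l => //.
exact: vge_cst.
Qed.

Lemma codim_steps P (z : int) w N r (b : 'I_N -> F) : has_residues P ->
    N = (w + r)%N -> indep b -> (forall i, vge P z (b i)) ->
  exists b' : 'I_r -> F, [/\ indep b', forall i, vge P (z + w%:Z) (b' i) &
    forall Q u, (forall i, vge Q u (b i)) -> forall i, vge Q u (b' i)].
Proof.
move=> resP eN; subst N; elim: w z b => [|w IHw] z b indep_b Pb.
  by exists b; rewrite addr0.
have [b1 [indep_b1 Pb1 Qb1]] := codim_step resP indep_b Pb.
have [b2 [indep_b2 Pb2 Qb2]] := IHw _ _ indep_b1 Pb1.
exists b2; split=> // [i|Q u /Qb1/Qb2//].
by have := Pb2 i; rewrite -addrA -PoszD add1n.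
Qed.

(** The places of T are treated in turn; the last clause of [codim_steps] keeps the bounds already
    reached. *)
Lemma codim_steps_seq (T : seq (place F)) (z : place F -> int)
    (w : place F -> nat) N r (b : 'I_N -> F) :
    (forall P, P \in T -> has_residues P) ->
    N = (\sum_(P <- T) w P + r)%N -> indep b ->
    (forall P i, P \in T -> vge P (z P) (b i)) ->
  exists b' : 'I_r -> F, [/\ indep b',
    forall P i, P \in T -> vge P (z P + (w P)%:Z) (b' i) &
    forall Q u, (forall i, vge Q u (b i)) -> forall i, vge Q u (b' i)].
Proof.
elim: T N b => [|P T IHT] N b resT eN indep_b Tb.
  by subst N; rewrite big_nil in b indep_b Tb *; exists b.
rewrite big_cons -addnA in eN.
have resP : has_residues P by apply: resT; rewrite mem_head.
have resT' Q : Q \in T -> has_residues Q by move=> QT; apply: resT;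
  rewrite inE QT orbT.
have Pb i : vge P (z P) (b i) by apply: Tb; rewrite mem_head.
have [b1 [indep_b1 Pb1 Qb1]] := codim_steps resP eN indep_b Pb.
have Tb1 Q i : Q \in T -> vge Q (z Q) (b1 i).
  by move=> QT; apply: Qb1 => j; apply: Tb; rewrite inE QT orbT.
have [b2 [indep_b2 Pb2 Qb2]] := IHT _ b1 resT' (erefl _) indep_b1 Tb1.
exists b2; split=> // [Q i|Q u /Qb1/Qb2//].
by rewrite inE => /predU1P[->|QT]; [apply: Qb2 | apply: Pb2].
Qed.

Lemma RRspaceP (D : divisor F) h :
  RRspace D h <-> forall P, vge P (- coeff P D) h.
Proof.
split=> [[->|PD] P|PD]; rewrite ?vge0 // /vge ?PD ?orbT //.
have [->|h0] := eqVneq h 0; first by left.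
by right=> P; rewrite -(vge_neq0 P _ h0).
Qed.

Lemma deg_sum_uniq (D : divisor F) (U : seq (place F)) : uniq U ->
    (forall P, P \notin U -> coeff P D = 0) ->
  divisor_deg D = \sum_(P <- U) coeff P D.
Proof.
move=> uniq_U UD; rewrite /divisor_deg -{1}(freeg_sumE D) raddf_sum /=.
rewrite (eq_bigr (fun P => coeff P D)); last by move=> P _; rewrite degU.
rewrite [RHS](bigID (mem (dom D))) /= [X in _ + X]big1 ?addr0; last first.
  by move=> P; rewrite mem_dom negbK => /eqP.
rewrite -[RHS]big_filter; apply: perm_big; apply: uniq_perm;
  rewrite ?uniq_dom ?filter_uniq //.
move=> P; rewrite mem_filter /=; case: (boolP (P \in dom D)) => //= PD.
by apply/esym; apply: contraTT PD => /UD e; rewrite mem_dom e eqxx.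
Qed.

End Independence.

(** * Riemann-Roch spaces and the value of the genus *)

Section Genus.

Variables (K : closedFieldType) (F : fieldExtType {fraction {poly K}}).
Variables (n d : nat) (f : {poly K}) (y : F) (oo : place F).
Hypothesis n_neq0 : n%:R != 0 :> K.
Hypothesis f_roots : distinct_roots f.
Hypothesis size_f : size f = d.+1.
Hypothesis co_nd : coprime n d.
Hypothesis eq_y : y ^+ n = ratfun F f.
Hypothesis gen_y : <<1%VS; y>>%VS = fullv.
Hypothesis oo_x : oo (xcoord F) < 0.
Implicit Types (P Q : place F).

Let n0 : (0 < n)%N := natr_neq0_gt0 n_neq0.

Lemma ord_ratfun_ge0 P (q : {poly K}) : P != oo -> 0 <= P (ratfun F q).
Proof.
move=> /(place_finite n_neq0 size_f co_nd eq_y gen_y oo_x) Px.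
have [->|q0] := eqVneq q 0; first by rewrite [ratfun F 0]rmorph0 ord_at0.
rewrite -(vge_neq0 P 0) ?ratfun_eq0 //.
by apply: vge_ratfun; rewrite /vge Px orbT.
Qed.

Lemma finite_has_residues P : P != oo -> has_residues P.
Proof.
move=> /(place_finite n_neq0 size_f co_nd eq_y gen_y oo_x) Px h.
have [a [b [on_c cP]]] := place_center n_neq0 size_f co_nd eq_y gen_y oo_x Px.
exact: (point_residue n_neq0 f_roots size_f co_nd eq_y gen_y oo_x on_c cP).
Qed.

Lemma ratfun_row_sum (q : {poly K}) k : (size q <= k)%N ->
  ratfun F q = \sum_(i <- iota 0 k) cst F q`_i * xcoord F ^+ i.
Proof.
move=> le_qk; have -> : iota 0 k = index_iota 0 k by rewrite /index_iota subn0.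
rewrite ratfun_sum.
rewrite -(big_mkord xpredT (fun i => cst F q`_i * xcoord F ^+ i)).
rewrite (big_cat_nat _ le_qk) //= [X in _ = _ + X]big1_seq ?addr0 // => i /=.
by rewrite mem_index_iota => /andP[le_i _]; rewrite nth_default // cst0 mul0r.
Qed.

Definition monom_basis M (i : 'I_(size (small_monoms n d M))) : F :=
  monom y (tnth (in_tuple (small_monoms n d M)) i).

Lemma monom_basis_deg M i : oo (@monom_basis M i) =
  - (mdeg d (tnth (in_tuple (small_monoms n d M)) i))%:Z.
Proof. exact: (ord_infty_monom n_neq0 size_f co_nd eq_y gen_y oo_x). Qed.

Lemma monom_basis_le M i : - M%:Z <= oo (@monom_basis M i).
Proof.
rewrite monom_basis_deg lerN2 lez_nat -mem_small_monoms //.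
exact: mem_tnth.
Qed.

Lemma monom_basis_inj M : injective (fun i => oo (@monom_basis M i)).
Proof.
move=> i j /=; rewrite !monom_basis_deg => /oppr_inj[] /(mdeg_inj n0 co_nd) e.
have := uniq_small_monoms n d M;
  rewrite -[small_monoms n d M]/(tval (in_tuple _)).
by move/tuple_uniqP; apply.
Qed.

Lemma monom_basis_neq0 M i : @monom_basis M i != 0.
Proof. exact: (monom_neq0 n_neq0 size_f eq_y oo_x). Qed.

(** h is p(x, y) with deg_y p < n. Terms do not cancel at infinity, so each has pole order at most
    M, which bounds the degree of each coefficient by its row. *)
Lemma monom_basis_span M h : (forall P, P != oo -> vge P 0 h) ->
  vge oo (- M%:Z) h -> exists c, h = \sum_i cst F (c i) * @monom_basis M i.
Proof.
move=> fin_h oo_h.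
have [p le_pn eh] := finite_integral n_neq0 f_roots size_f co_nd eq_y gen_y
  oo_x fin_h.
have le_row (j : 'I_n) : (size (p`_j)%R <= row_size n d M j)%N.
  have [->|pj0] := eqVneq p`_j 0; first by rewrite size_poly0.
  have p0 : p != 0 by apply: contraNneq pj0 => ->; rewrite coef0.
  have [Px Py] := infty_ord n0 eq_y gen_y size_f co_nd oo_x.
  rewrite -[n%:Z]mulr1 -[d%:Z]mulr1 in Px Py.
  have [pp0 [_ [_ _ /(_ j)]]] := ord_polyfun_infty n0 eq_y size_f co_nd ltr01
    Px Py le_pn p0.
  have y0 := curve_y_neq0 n0 eq_y size_f.
  rewrite -eh in pp0 *; rewrite !vge_neq0 ?mulf_neq0 ?ratfun_eq0
    ?expf_neq0 // in oo_h *.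
  rewrite (ord_term_infty n0 eq_y size_f co_nd ltr01 Px Py) // mulr1 => le_h.
  have := le_trans oo_h le_h; rewrite lerN2 lez_nat -ltn_row_size //.
  by rewrite prednK // size_poly_gt0.
exists (fun i => let m := tnth (in_tuple (small_monoms n d M)) i in
  (p`_(m.1))`_(m.2)).
rewrite eh (polyfun_sum y le_pn) /monom_basis.
rewrite -(big_tnth _ _ (small_monoms n d M) xpredT
  (fun m => cst F (p`_(m.1))`_(m.2) * monom y m)) big_allpairs_dep /= big_enum
    /=.
apply: eq_bigr => j _; rewrite (ratfun_row_sum (le_row j)) mulr_suml.
by apply: eq_bigr => i _; rewrite /monom /= mulrA.
Qed.

Lemma has_dim_infty M :
  has_dim (RRspace (<< M%:Z *g oo >> : divisor F)) (size (small_monoms n d M)).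
Proof.
have coefE P : coeff P << M%:Z *g oo >> = if P == oo then M%:Z else 0.
  by rewrite coeffU eq_sym; case: eqP => _; rewrite ?mulr1 ?mulr0.
exists (@monom_basis M); split.
  exact: (indep_ord_inj (@monom_basis_neq0 M) (@monom_basis_inj M)).
move=> h; rewrite RRspaceP; split=> [Dh|[c ->] P].
  apply: monom_basis_span => [P Poo|].
    by have := Dh P; rewrite coefE (negPf Poo) oppr0.
  by have := Dh oo; rewrite coefE eqxx.
apply: vge_sum => i _; apply: vgeM0l; last exact: vge_cst.
rewrite coefE vge_neq0 ?monom_basis_neq0 //; case: eqP => [->|/eqP Poo].
  exact: monom_basis_le.
by rewrite oppr0; apply: (vge_monom n_neq0 size_f co_nd eq_y gen_y oo_x).
Qed.

(** A product of powers of x - a, over the centers a of the finite places in s. The exponent |D(P)|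
    suffices because x - a has order at least 1 at P. *)
Lemma dominating_poly (D : divisor F) (s : seq (place F)) :
  exists2 q : {poly K}, q != 0 &
    forall P, P \in s -> P != oo -> `|coeff P D| <= P (ratfun F q).
Proof.
elim: s => [|P s [q q0 qs]]; first by exists 1; rewrite ?oner_neq0.
have [Poo|Poo] := eqVneq P oo.
  exists q => // P'; rewrite inE => /predU1P[->|]; last exact: qs.
  by rewrite Poo eqxx.
have Px := place_finite n_neq0 size_f co_nd eq_y gen_y oo_x Poo.
have Px' : vge P 0 (xcoord F) by rewrite /vge Px orbT.
have [a Pa] := place_x_center n_neq0 size_f co_nd eq_y gen_y oo_x Px'.
have xa0 : ('X - a%:P) != 0 :> {poly K} by rewrite polyXsubC_eq0.
have xam0 : ('X - a%:P) ^+ absz (coeff P D) != 0 :> {poly K}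
  by rewrite expf_neq0.
exists (('X - a%:P) ^+ absz (coeff P D) * q); first by rewrite mulf_neq0.
move=> P'; rewrite inE ratfunM => P's P'oo; rewrite ord_atM ?ratfun_eq0 //.
case/predU1P: P's => [->|P's]; last first.
  by apply: le_trans (qs _ P's P'oo) _; rewrite lerDr ord_ratfun_ge0.
rewrite -[leLHS]addr0 lerD ?ord_ratfun_ge0 //.
rewrite [ratfun F (_ ^+ _)]rmorphXn /= ratfun_XsubC ordX intMrn.
rewrite -ratfun_XsubC vge_neq0 ?ratfun_eq0 // ratfun_XsubC in Pa.
by rewrite abszE -{1}[`|_|]mul1r ler_wpM2r.
Qed.

(** q splits into factors x - a, and each fibre contributes at most n by [places_above]. *)
Lemma places_of_poly (q : {poly K}) : q != 0 -> exists T : seq (place F),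
  [/\ uniq T, forall P, (P \in T) = (P != oo) && (0 < P (ratfun F q)) &
   \sum_(P <- T) P (ratfun F q) <= n%:Z * (size q).-1%:Z].
Proof.
move=> q0; have [rs eq] := closed_field_poly_normal q.
have ordq P : P (ratfun F q) = \sum_(a <- rs) P (xcoord F - cst F a).
  have xa0 a : xcoord F - cst F a != 0.
    by rewrite -ratfun_XsubC ratfun_eq0 polyXsubC_eq0.
  have c0 : cst F (lead_coef q) != 0 by rewrite cst_eq0 lead_coef_eq0.
  have -> : ratfun F q = cst F (lead_coef q) * \prod_(a <- rs) (xcoord F - cst
    F a).
    rewrite {1}eq -mul_polyC ratfunM ratfunC rmorph_prod /=; congr (_ * _).
    by apply: eq_bigr => a _; apply: ratfun_XsubC.
  have [p0 <-] : \prod_(a <- rs) (xcoord F - cst F a) != 0 /\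
      P (\prod_(a <- rs) (xcoord F - cst F a)) =
        \sum_(a <- rs) P (xcoord F - cst F a).
    elim: (rs) => [|a s [s0 IHs]]; first by rewrite !big_nil oner_neq0 ord1.
    by rewrite !big_cons mulf_neq0 // ord_atM // IHs.
  by rewrite ord_atM // ord_at_cst add0r.
have xa_ge0 P a : P != oo -> 0 <= P (xcoord F - cst F a).
  by move=> Poo; rewrite -ratfun_XsubC ord_ratfun_ge0.
have [tl tlP] := choice (places_above n_neq0 f_roots size_f co_nd eq_y gen_y
  oo_x).
pose T := [seq P <- undup (flatten (map tl rs)) | (P != oo) && (0 < P (ratfun
  F q))].
have T_oo P : P \in T -> P != oo by rewrite mem_filter => /andP[/andP[]].
have uniq_T : uniq T by rewrite filter_uniq ?undup_uniq.
exists T; split=> //.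
  move=> P; rewrite mem_filter mem_undup; apply: andb_idr => /andP[Poo].
  apply: contraTT => /flatten_mapP noP; rewrite -leNgt ordq.
  rewrite big_seq sumr_le0 // => a a_rs; rewrite leNgt; apply/negP => Pa.
  by apply: noP; exists a => //; have [_ -> _] := tlP a.
have -> : (size q).-1 = size rs.
  by rewrite {1}eq size_scale ?lead_coef_eq0 // size_prod_XsubC.
rewrite (eq_bigr _ (fun P _ => ordq P)) exchange_big /= -intMrn.
rewrite -[X in _ <= X](_ : \sum_(a <- rs) n%:Z = _); last first.
  by rewrite big_const_seq count_predT iter_addr_0.
apply: ler_sum => a _; have [uniq_a memE sum_a] := tlP a; apply: le_trans sum_a.
rewrite [leLHS](bigID (mem (tl a))) /= [X in _ + X]big_seq_cond.
rewrite [X in _ + X]big1 ?addr0; last first.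
  move=> P /andP[PT]; rewrite memE -leNgt => Pa.
  by apply/le_anti; rewrite Pa xa_ge0 // T_oo.
rewrite -big_filter (perm_big [seq P <- tl a | P \in T]); last first.
  apply: uniq_perm => [||P]; [exact: filter_uniq..|].
  by rewrite [LHS]mem_filter [RHS]mem_filter andbC.
rewrite big_filter [leRHS](bigID (mem T)) /= lerDl.
rewrite big_seq_cond sumr_ge0 // => P /andP[]; rewrite memE => /ltW Pa _.
exact: Pa.
Qed.

(** Let M = D(oo) + n deg q, where q dominates D. The N monomials of pole order at most M, divided
    by q, meet the condition of D at infinity and have order at least -P(q) elsewhere. Raising this
    to -D(P) at the zeros of q takes P(q) - D(P) conditions each, in total at most n deg q minus the
    finite part of deg D. So l(D) is at least N minus that, and N >= M + 1 - (n-1)(d-1)/2. *)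
Lemma genus_le (D : divisor F) l : (0 < d)%N -> has_dim (RRspace D) l ->
  2 * (divisor_deg D + 1 - l%:Z) <= (n%:Z - 1) * (d%:Z - 1).
Proof.
move=> d_gt0 [v [_ vP]].
have [q q0 qD] := dominating_poly D (dom D).
have [T [uniq_T memT sumT]] := places_of_poly q0.
have ooT : oo \notin T by rewrite memT eqxx.
have coef0 P : P != oo -> P \notin T -> coeff P D = 0.
  move=> Poo; rewrite memT Poo /= -leNgt => Pq.
  apply/eqP; rewrite -[_ == 0]negbK -mem_dom; apply/negP => PD.
  move: (PD); rewrite mem_dom -normr_gt0; apply/negP; rewrite -leNgt.
  exact: le_trans (qD P PD Poo) Pq.
have leD P : P != oo -> coeff P D <= P (ratfun F q).
  move=> Poo; have [PD|] := boolP (P \in dom D).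
    exact: le_trans (ler_norm _) (qD P PD Poo).
  by rewrite mem_dom negbK => /eqP->; apply: ord_ratfun_ge0.
have degD : divisor_deg D = coeff oo D + \sum_(P <- T) coeff P D.
  rewrite (@deg_sum_uniq _ _ D (oo :: T)) ?big_cons //= ?ooT // => P.
  by rewrite inE negb_or => /andP[]; apply: coef0.
pose w P := absz (P (ratfun F q) - coeff P D).
have wE P : P \in T -> (w P)%:Z = P (ratfun F q) - coeff P D.
  by rewrite memT => /andP[Poo _]; rewrite /w gez0_abs // subr_ge0 leD.
have sumw : (\sum_(P <- T) w P)%N%:Z =
    \sum_(P <- T) P (ratfun F q) - \sum_(P <- T) coeff P D.
  rewrite (big_morph Posz PoszD (erefl (Posz 0))) -sumrB.
  by rewrite big_seq [RHS]big_seq; apply: eq_bigr => P PT; rewrite wE.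
have nd_ge0 : 0 <= (n%:Z - 1) * (d%:Z - 1)
  by rewrite mulr_ge0 ?subr_ge0 ?lez_nat.
(* Here deg D <= D(oo) + n deg q < 0, so the left side is at most 0. *)
have [M_lt0|M_ge0] := ltP (coeff oo D + n%:Z * (size q).-1%:Z) 0; first by lia.
pose M := absz (coeff oo D + n%:Z * (size q).-1%:Z).
have eM : M%:Z = coeff oo D + n%:Z * (size q).-1%:Z by rewrite gez0_abs.
have := size_small_monoms_ge n0 co_nd M.
set N := size _ => geN.
(* With fewer functions than conditions, the bound follows from [geN] and l >= 0. *)
have [lt_N|le_N] := ltnP N (\sum_(P <- T) w P)%N; first by lia.
have qF0 : ratfun F q != 0 by rewrite ratfun_eq0.
pose b (i : 'I_N) := monom_basis i / ratfun F q.
have b0 i : b i != 0 by rewrite mulf_neq0 ?invr_eq0 ?monom_basis_neq0.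
have ordb P i : P (b i) = P (monom_basis i) - P (ratfun F q).
  by rewrite ord_atM ?invr_eq0 ?monom_basis_neq0 // ordV.
have indep_b : indep b.
  apply: (indep_ord_inj (P := oo)) => // i j /=; rewrite !ordb => /addIr.
  exact: monom_basis_inj.
have b_ge P i : P != oo -> vge P (- P (ratfun F q)) (b i).
  move=> Poo; rewrite vge_neq0 ?b0 // ordb lerDr.
  exact: (vge_monom n_neq0 size_f co_nd eq_y gen_y oo_x).
have eN : N = (\sum_(P <- T) w P + (N - \sum_(P <- T) w P))%N by rewrite subnKC.
have T_oo P : P \in T -> P != oo by rewrite memT => /andP[].
have [b' [indep_b' Tb' Qb']] := codim_steps_seq
  (fun P PT => finite_has_residues (T_oo P PT)) eN indep_b
  (fun P i PT => b_ge P i (T_oo P PT)).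
have b'D i : RRspace D (b' i).
  apply/RRspaceP => P; have [->|Poo] := eqVneq P oo.
    apply: Qb' => j; rewrite vge_neq0 ?b0 // ordb.
    rewrite (ord_ratfun_infty oo_x q0).
    have [-> _] := infty_ord n0 eq_y gen_y size_f co_nd oo_x.
    by have := @monom_basis_le M j; rewrite intMrn; lia.
  have [PT|PT] := boolP (P \in T).
    by have := Tb' P i PT; rewrite wE // addrA addNr add0r.
  rewrite coef0 //; apply: Qb' => j; apply: vge_le (b_ge P j Poo).
  by rewrite oppr0 oppr_ge0; move: PT; rewrite memT Poo /= -leNgt.
have := indep_le_span indep_b' (fun i => (vP (b' i)).1 (b'D i)).
by rewrite -lez_nat -subzn // sumw; lia.
Qed.

(** One inequality is [genus_le] for a divisor attaining the maximum; the other uses D = dn oo,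
    large enough for the exact monomial count. *)
Lemma genus_formula g : (0 < d)%N -> is_genus F g ->
  2 * g%:Z = (n%:Z - 1) * (d%:Z - 1).
Proof.
move=> d_gt0 [ge_g [D [l [Dl eg]]]]; apply/le_anti/andP; split.
  by rewrite -eg; apply: genus_le.
have := ge_g _ _ (has_dim_infty (d * n)); rewrite /divisor_deg degU.
have := @size_small_monoms_eq n d n0 co_nd (d * n).
have -> : (d * n.-1 <= d * n + n)%N.
  by apply: leq_trans (leq_addr _ _); rewrite leq_mul2l leq_pred orbT.
by move/(_ isT); lia.
Qed.

End Genus.

(** * The entries of the matrix *)

Section Entries.

Variables (K : closedFieldType) (F : fieldExtType {fraction {poly K}}).
Variables (n d g : nat) (f : {poly K}) (y : F) (oo : place F).
Hypothesis n_neq0 : n%:R != 0 :> K.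
Hypothesis f_roots : distinct_roots f.
Hypothesis size_f : size f = d.+1.
Hypothesis lt_nd : (n < d)%N.
Hypothesis co_nd : coprime n d.
Hypothesis curve_F : superelliptic n f y.
Hypothesis oo_x : oo (xcoord F) < 0.
Hypothesis genus_g : is_genus F g.

(** Exactly 2g + 1 monomials have pole order at most 3g. For m among them, m and the monomials below
    it fit in that list; for any other m, the list itself gives 2g + 1 monomials of smaller pole
    order. *)
Lemma among_firstE (m : 'I_n * nat) :
  `[< among_first y oo (2 * g + 1)%N m >] = (mdeg d m <= 3 * g)%N.
Proof.
have [eq_y gen_y] := curve_F; have n0 := natr_neq0_gt0 n_neq0.
have d_gt0 : (0 < d)%N by apply: leq_trans lt_nd.
have eg := genus_formula n_neq0 f_roots size_f co_nd eq_y gen_y oo_x d_gt0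
  genus_g.
have poleE (m' : 'I_n * nat) : pole_order y oo m' = (mdeg d m')%:Z.
  by rewrite /pole_order (ord_infty_monom n_neq0 size_f co_nd eq_y gen_y oo_x)
    opprK.
have size3g : size (small_monoms n d (3 * g)) = (2 * g + 1)%N.
  (* The count at M = 3g is exact only if the last row j = n - 1 satisfies dj <= 3g + n. *)
  have le_3g : (d * n.-1 <= 3 * g + n)%N by nia.
  have := size_small_monoms_eq n0 co_nd le_3g; lia.
apply/asboolP/idP => [first_m|le_m s uniq_s lt_s].
  rewrite leqNgt; apply/negP => lt_m.
  suff: (2 * g + 1 < 2 * g + 1)%N by rewrite ltnn.
  rewrite -{1}size3g; apply: first_m => [|m']; first exact: uniq_small_monoms.
  by rewrite mem_small_monoms // !poleE ltz_nat => /leq_ltn_trans; apply.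
have uniq_ms : uniq (m :: s).
  by rewrite /= uniq_s andbT; apply/negP => /lt_s; rewrite ltxx.
rewrite -size3g; apply: (uniq_leq_size uniq_ms) => m'.
rewrite inE mem_small_monoms // => /predU1P[->//|/lt_s].
by rewrite !poleE ltz_nat => /ltnW/leq_trans; apply.
Qed.

(** The bound is ni + dj <= 3g divided by n. The integer floor is negative when jd > 3g, and the row
    is then zero. *)
Lemma Bentry_neq0 (j : 'I_n) (i : nat) :
  (Bentry y oo g j i != 0) =
    (i%:Z <= (((3 * g)%N%:Z - (j * d)%N%:Z) %/ n%:Z)%Z).
Proof.
have [eq_y _] := curve_F; have n0 := natr_neq0_gt0 n_neq0.
rewrite /Bentry among_firstE lez_divRL
  ?ltz_nat // lerBrDr -PoszM -PoszD lez_nat.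
rewrite [(i * n)%N]mulnC [(j * d)%N]mulnC -[(_ + _)%N]/(mdeg d (j, i)).
by case: ifP; rewrite ?eqxx // (monom_neq0 n_neq0 size_f eq_y oo_x).
Qed.

Lemma Bentry_monom (j : 'I_n) (i : nat) : Bentry y oo g j i != 0 ->
  Bentry y oo g j i = xcoord F ^+ i * y ^+ j.
Proof. by rewrite /Bentry; case: ifP => //; rewrite eqxx. Qed.

End Entries.

Theorem theorem5p5 (K : closedFieldType) (F : fieldExtType {fraction {poly K}})
    (n d g : nat) (f : {poly K}) (y : F) (oo : place F)
    (hchar : n%:R != 0 :> K)
    (hf : distinct_roots f) (hd : size f = d.+1)
    (hnd : (n < d)%N) (hco : coprime n d)
    (hF : superelliptic n f y)
    (hoo : oo (xcoord F) < 0)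
    (hg : is_genus F g) :
  (forall (j : 'I_n) (i : nat),
     (Bentry y oo g j i != 0) =
       (i%:Z <= (((3 * g)%N%:Z - (j * d)%N%:Z) %/ n%:Z)%Z) /\
     (Bentry y oo g j i != 0 ->
       Bentry y oo g j i = xcoord F ^+ i * y ^+ j)) /\
  (forall (j : 'I_n) (i : 'I_d.+1),
     (Bmx n y oo g d j i != 0) =
       ((i : nat)%:Z <= (((3 * g)%N%:Z - (j * d)%N%:Z) %/ n%:Z)%Z) /\
     (Bmx n y oo g d j i != 0 ->
       Bmx n y oo g d j i = xcoord F ^+ i * y ^+ j)).
Proof.
have neq0 := Bentry_neq0 hchar hf hd hnd hco hF hoo hg.
split=> j i; first by split; [exact: neq0 | exact: Bentry_monom].
by rewrite mxE; split; [exact: neq0 | exact: Bentry_monom].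
Qed.
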